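(* Let $A$ be a non-degenerate algebra over $\mathbb C$ and let $\Delta:A\to M(A\otimes A)$ be a coproduct on $A$. If the canonical maps $T_1$ and $T_4$ are regular and there exist a faithful left integral and a faithful right integral on $A$, then $(A,\Delta)$ is a regular multiplier Hopf algebra. If the canonical maps $T_2$ and $T_3$ are regular and there exist a faithful left integral and a faithful right integral on $A$, then $(A,\Delta)$ is a regular multiplier Hopf algebra.
   Context: Algebras are associative over $\mathbb C$, not necessarily unital. $A$ is non-degenerate if for $a\in A$: $ab=0$ for all $b\in A$ implies $a=0$, and $ba=0$ for all $b\in A$ implies $a=0$. $M(A)$, $M(A\otimes A)$ are the multiplier algebras, $\otimes$ is the algebraic tensor product, $\iota$ is the identity map. Canonical maps of a linear map $\Delta:A\to M(A\otimes A)$ (from $A\otimes A$ to $M(A\otimes A)$): $T_1(a\otimes b)=\Delta(a)(1\otimes b)$, $T_2(c\otimes a)=(c\otimes 1)\Delta(a)$, $T_3(a\otimes b)=(1\otimes b)\Delta(a)$, $T_4(c\otimes a)=\Delta(a)(c\otimes 1)$. A canonical map is regular if its range lies in $A\otimes A$. A coproduct is an algebra homomorphism $\Delta:A\to M(A\otimes A)$ (not assumed non-degenerate or full) for which one of the pairs $(T_1,T_2)$, $(T_3,T_4)$, $(T_1,T_4)$, $(T_2,T_3)$ is regular and the corresponding coassociativity holds for all $a,b,c\in A$ (if several pairs are regular, the corresponding forms are equivalent): $(T_1,T_2)$: $(c\otimes 1\otimes 1)(\Delta\otimes\iota)(\Delta(a)(1\otimes b))=(\iota\otimes\Delta)((c\otimes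 1)\Delta(a))(1\otimes 1\otimes b)$; $(T_3,T_4)$: $(\Delta\otimes\iota)((1\otimes b)\Delta(a))(c\otimes 1\otimes 1)=(1\otimes 1\otimes b)(\iota\otimes\Delta)(\Delta(a)(c\otimes 1))$; $(T_1,T_4)$: $(\Delta\otimes\iota)(\Delta(a)(1\otimes b))(c\otimes 1\otimes 1)=(\iota\otimes\Delta)(\Delta(a)(c\otimes 1))(1\otimes 1\otimes b)$; $(T_2,T_3)$: $(c\otimes 1\otimes 1)(\Delta\otimes\iota)((1\otimes b)\Delta(a))=(1\otimes 1\otimes b)(\iota\otimes\Delta)((c\otimes 1)\Delta(a))$. A left integral (defined if $T_2$ or $T_4$ is regular) is a non-zero linear functional $\varphi$ on $A$ with $(\iota\otimes\varphi)((c\otimes 1)\Delta(a)(c'\otimes 1))=\varphi(a)cc'$ for all $a,c,c'\in A$. A right integral (defined if $T_1$ or $T_3$ is regular) is a non-zero linear functional $\psi$ on $A$ with $(\psi\otimes\iota)((1\otimes b')\Delta(a)(1\otimes b))=\psi(a)b'b$ for all $a,b,b'\in A$. A linear functional $\omega$ on $A$ is left faithful if $\omega(ab)=0$ for all $b\in A$ implies $a=0$; right faithful if $\omega(ca)=0$ for all $c\in A$ implies $a=0$; faithful if both. $(A,\Delta)$ is a multiplier Hopf algebra if $A$ is non-degenerate, $\Delta$ is a coproduct with $T_1,T_2$ regular, and $T_1,T_2$ are bijections from $A\otimes A$ to $A\otimes A$. It is a regular multiplier Hopf algebra if moreover $T_3$ and $T_4$ are regular and are bijections from $A\otimes A$ to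 $A\otimes A$. *)

(* Defs.v *)
From HB Require Import structures.
From mathcomp Require Import all_boot all_order all_algebra.
From mathcomp Require Import generic_quotient sesquilinear.
From mathcomp Require Import all_classical reals.
From mathcomp Require Export complex.

Set Implicit Arguments.
Unset Strict Implicit.
Unset Printing Implicit Defensive.

Import Order.TTheory GRing.Theory Num.Theory.

Declare Scope mhopf_scope.
Delimit Scope mhopf_scope with H.

Local Open Scope ring_scope.
Local Open Scope quotient_scope.
Local Open Scope mhopf_scope.

Notation "a · b" := (a * b)%g (at level 40, left associativity) : mhopf_scope.

(* Associative, not necessarily unital algebras. Since the rings of the library
   are unital, the product is that of a semigroup, written [a · b]; the vector space
   operations are those of [ring_scope]. *)
HB.mixin Record Lmodule_Semigroup_isNuAlgebra (K : pzRingType) A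
    of GRing.Lmodule K A & Semigroup A := {
  nu_mulDl : forall a b c : A, (a + b) · c = a · c + b · c ;
  nu_mulDr : forall a b c : A, a · (b + c) = a · b + a · c ;
  nu_mulZl : forall (k : K) (a b : A), (k *: a) · b = k *: (a · b) ;
  nu_mulZr : forall (k : K) (a b : A), a · (k *: b) = k *: (a · b)
}.

#[short(type="nuAlgType")]
HB.structure Definition NuAlgebra (K : pzRingType) :=
  {A of Lmodule_Semigroup_isNuAlgebra K A & GRing.Lmodule K A & Semigroup A}.

Definition nondegenerate_algebra (K : pzRingType) (A : nuAlgType K) : Prop :=
  (forall a : A, (forall b, a · b = 0) -> a = 0) /\
  (forall a : A, (forall b, b · a = 0) -> a = 0).

Section TensorDef.
Context {K : fieldType} (U V : lmodType K).

(* A sequence of pairs stands for the formal sum of the corresponding simple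
   tensors. [tensor_cong] is the congruence generated by commutativity and
   bilinearity; scalars and signs are absorbed in the first component. *)
Inductive tensor_cong : seq (U * V) -> seq (U * V) -> Prop :=
| tc_refl s : tensor_cong s s
| tc_sym s t : tensor_cong s t -> tensor_cong t s
| tc_trans s t r : tensor_cong s t -> tensor_cong t r -> tensor_cong s r
| tc_cat s s' t t' :
    tensor_cong s s' -> tensor_cong t t' -> tensor_cong (s ++ t) (s' ++ t')
| tc_comm s t : tensor_cong (s ++ t) (t ++ s)
| tc_0l v : tensor_cong [:: (0, v)] [::]
| tc_Dl u u' v : tensor_cong [:: (u + u', v)] [:: (u, v); (u', v)]
| tc_Dr u v v' : tensor_cong [:: (u, v + v')] [:: (u, v); (u, v')]
| tc_Z k u v : tensor_cong [:: (k *: u, v)] [:: (u, k *: v)].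

Definition tensor_rel : rel (seq (U * V)) := fun s t => `[< tensor_cong s t >].

Lemma tensor_rel_equiv : equiv_class_of tensor_rel.
Proof.
split=> [s|s t|t s r]; rewrite /tensor_rel.
- by apply/asboolP; exact: tc_refl.
- by apply/asboolP/asboolP; exact: tc_sym.
- by move=> /asboolP h1 /asboolP h2; apply/asboolP; exact: tc_trans h1 h2.
Qed.

Canonical tensor_equiv := EquivRelPack tensor_rel_equiv.

Definition tensor := {eq_quot tensor_equiv}.

HB.instance Definition _ := Choice.on tensor.
HB.instance Definition _ := EqQuotient.on tensor.

Definition tens (u : U) (v : V) : tensor := \pi_tensor [:: (u, v)].

Definition tensor_add (x y : tensor) : tensor := \pi_tensor (repr x ++ repr y).
Definition tensor_scale (k : K) (x : tensor) : tensor :=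
  \pi_tensor [seq (k *: p.1, p.2) | p <- repr x].

Lemma tensor_piP s t : \pi_tensor s = \pi_tensor t <-> tensor_cong s t.
Proof.
split; first by move=> /eqmodP /asboolP.
by move=> h; apply/eqmodP; apply/asboolP.
Qed.

Lemma tc_repr s : tensor_cong (repr (\pi_tensor s)) s.
Proof. by apply/tensor_piP; rewrite reprK. Qed.

Lemma tensor_add_pi s t :
  tensor_add (\pi_tensor s) (\pi_tensor t) = \pi_tensor (s ++ t).
Proof. by apply/tensor_piP; apply: tc_cat; exact: tc_repr. Qed.

Lemma tc_scale k s t : tensor_cong s t ->
  tensor_cong [seq (k *: p.1, p.2) | p <- s] [seq (k *: p.1, p.2) | p <- t].
Proof.
elim=> {s t}.
- by move=> s; exact: tc_refl.
- by move=> s t _; exact: tc_sym.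
- by move=> s t r _ h1 _; exact: tc_trans h1.
- by move=> s s' t t' _ h1 _ h2; rewrite !map_cat; exact: tc_cat.
- by move=> s t; rewrite !map_cat; exact: tc_comm.
- by move=> v /=; rewrite scaler0; exact: tc_0l.
- by move=> u u' v /=; rewrite scalerDr; exact: tc_Dl.
- by move=> u v v' /=; exact: tc_Dr.
- move=> l u v /=; rewrite scalerA mulrC -scalerA; exact: tc_Z.
Qed.

Lemma tensor_scale_pi k s :
  tensor_scale k (\pi_tensor s) = \pi_tensor [seq (k *: p.1, p.2) | p <- s].
Proof. by apply/tensor_piP; apply: tc_scale; exact: tc_repr. Qed.

Fact tensor_addA : associative tensor_add.
Proof.
elim/quotW=> s; elim/quotW=> t; elim/quotW=> r.
by rewrite (tensor_add_pi t r) (tensor_add_pi s t) !tensor_add_pi catA.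
Qed.

Fact tensor_addC : commutative tensor_add.
Proof. by move=> x y; apply/tensor_piP; exact: tc_comm. Qed.

Fact tensor_add0 : left_id (\pi_tensor [::]) tensor_add.
Proof. by elim/quotW=> s; rewrite (tensor_add_pi [::] s). Qed.

Lemma tc_catACA s t s' t' :
  tensor_cong ((s ++ t) ++ (s' ++ t')) ((s ++ s') ++ (t ++ t')).
Proof.
rewrite -!catA; apply: tc_cat; first exact: tc_refl.
by rewrite !catA; apply: tc_cat; [exact: tc_comm|exact: tc_refl].
Qed.

Fact tensor_addN : left_inverse (\pi_tensor [::]) (tensor_scale (-1)) tensor_add.
Proof.
elim/quotW=> s; rewrite (tensor_scale_pi _ s) tensor_add_pi; apply/tensor_piP.
elim: s => [|[u v] s ih] /=; first exact: tc_refl.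
apply: (tc_trans (tc_catACA [:: _] _ [:: _] _)).
rewrite -[[::]]/([::] ++ [::]); apply: tc_cat ih.
apply: tc_trans (tc_0l v); apply: tc_sym.
by rewrite -(addNr u) -scaleN1r; exact: tc_Dl.
Qed.

HB.instance Definition _ := GRing.isZmodule.Build tensor
  tensor_addA tensor_addC tensor_add0 tensor_addN.

Lemma tensorD_pi s t : \pi_tensor s + \pi_tensor t = \pi_tensor (s ++ t).
Proof. exact: tensor_add_pi. Qed.

Fact tensor_scaleA k l x :
  tensor_scale k (tensor_scale l x) = tensor_scale (k * l)%R x.
Proof.
elim/quotW: x => s; rewrite (tensor_scale_pi l s) !tensor_scale_pi -map_comp.
congr (\pi _).
by apply: eq_map => p /=; rewrite scalerA.
Qed.

Fact tensor_scale1 : left_id 1%R tensor_scale.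
Proof.
elim/quotW=> s; rewrite (tensor_scale_pi _ s); congr (\pi _).
by rewrite -[RHS]map_id; apply: eq_map => -[u v] /=; rewrite scale1r.
Qed.

Fact tensor_scaleDr : right_distributive tensor_scale +%R.
Proof.
move=> k; elim/quotW=> s; elim/quotW=> t; rewrite tensorD_pi.
by rewrite (tensor_scale_pi k s) (tensor_scale_pi k t) tensor_scale_pi map_cat tensorD_pi.
Qed.

Fact tensor_scaleDl x : {morph tensor_scale^~ x : k l / k + l}.
Proof.
move=> k l; elim/quotW: x => s.
rewrite (tensor_scale_pi k s) (tensor_scale_pi l s) tensor_scale_pi tensorD_pi.
apply/tensor_piP; elim: s => [|[u v] s ih] /=; first exact: tc_refl.
apply: tc_trans (tc_catACA [:: _] [:: _] _ _).
by rewrite -[_ :: map _ _]cat1s; apply: tc_cat ih; rewrite scalerDl; exact: tc_Dl.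
Qed.

HB.instance Definition _ := GRing.Zmodule_isLmodule.Build K tensor
  tensor_scaleA tensor_scale1 tensor_scaleDr tensor_scaleDl.

End TensorDef.

Notation "u ⊗ v" := (tens u v) (at level 40, left associativity) : mhopf_scope.

(* The linear map U ⊗ V -> W induced by a bilinear map f (see [tensor_lift_tens] and
   [tensor_lift_is_linear]); it is only meaningful when f is bilinear. *)
Definition tensor_lift (K : fieldType) (U V W : lmodType K) (f : U -> V -> W)
    (x : tensor U V) : W :=
  \sum_(p <- repr x) f p.1 p.2.

Notation bilin f := (bilinear_for *:%R *:%R f).

Section TensorTheory.
Context {K : fieldType}.
Implicit Types U V W : lmodType K.

Lemma bilinP U V W (f : U -> V -> W) :
  (forall u u' v, f (u + u') v = f u v + f u' v) ->
  (forall u v v', f u (v + v') = f u v + f u v') ->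
  (forall k u v, f (k *: u) v = k *: f u v) ->
  (forall k u v, f u (k *: v) = k *: f u v) -> bilin f.
Proof.
move=> hDl hDr hZl hZr; split=> [v k u u'|u k v v'] /=.
  by rewrite hDl hZl.
by rewrite hDr hZr.
Qed.

Section Bilin.
Context U V W (f : U -> V -> W) (hf : bilin f).

Lemma bilinDl u u' v : f (u + u') v = f u v + f u' v.
Proof. by have := hf.1 v 1%R u u'; rewrite /= !scale1r. Qed.
Lemma bilinDr u v v' : f u (v + v') = f u v + f u v'.
Proof. by have := hf.2 u 1%R v v'; rewrite /= !scale1r. Qed.
Lemma bilin0l v : f 0 v = 0.
Proof. by apply: (addrI (f 0 v)); rewrite -bilinDl !addr0. Qed.
Lemma bilin0r u : f u 0 = 0.
Proof. by apply: (addrI (f u 0)); rewrite -bilinDr !addr0. Qed.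
Lemma bilinZl k u v : f (k *: u) v = k *: f u v.
Proof. by have := hf.1 v k u 0; rewrite /= !addr0 bilin0l addr0. Qed.
Lemma bilinZr k u v : f u (k *: v) = k *: f u v.
Proof. by have := hf.2 u k v 0; rewrite /= !addr0 bilin0r addr0. Qed.

Lemma tensor_lift_pi s : tensor_lift f (\pi_(tensor U V) s) = \sum_(p <- s) f p.1 p.2.
Proof.
rewrite /tensor_lift; move: (tc_repr s); move: (repr _) => t; elim=> {s t} //.
- by move=> s t r _ -> _ ->.
- by move=> s s' t t' _ h1 _ h2; rewrite !big_cat /= h1 h2.
- by move=> s t; rewrite !big_cat /= addrC.
- by move=> v; rewrite big_seq1 big_nil bilin0l.
- by move=> u u' v; rewrite !big_cons !big_nil !addr0 bilinDl.
- by move=> u v v'; rewrite !big_cons !big_nil !addr0 bilinDr.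
- by move=> k u v; rewrite !big_cons !big_nil !addr0 bilinZl bilinZr.
Qed.

Lemma tensor_lift_tens u v : tensor_lift f (u ⊗ v) = f u v.
Proof. by rewrite /tens tensor_lift_pi big_seq1. Qed.

Lemma tensor_liftD x y : tensor_lift f (x + y) = tensor_lift f x + tensor_lift f y.
Proof.
by rewrite -(reprK x) -(reprK y) tensorD_pi !tensor_lift_pi big_cat.
Qed.

Lemma tensor_liftZ k x : tensor_lift f (k *: x) = k *: tensor_lift f x.
Proof.
elim/quotW: x => s.
have -> : k *: \pi_(tensor U V) s = \pi_(tensor U V) [seq (k *: p.1, p.2) | p <- s].
  exact: tensor_scale_pi.
rewrite !tensor_lift_pi big_map scaler_sumr.
by apply: eq_bigr => p _; rewrite bilinZl.
Qed.

Lemma tensor_lift_is_linear : linear (tensor_lift f).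
Proof. by move=> k x y; rewrite tensor_liftD tensor_liftZ. Qed.

Lemma tensor_lift0 : tensor_lift f 0 = 0.
Proof. by rewrite -(scale0r 0) tensor_liftZ scale0r. Qed.

End Bilin.

Lemma tens_bilin U V : bilin (@tens K U V).
Proof.
apply: bilinP => [u u' v|u v v'|k u v|k u v].
- by rewrite [RHS]tensorD_pi; apply/tensor_piP; exact: tc_Dl.
- by rewrite [RHS]tensorD_pi; apply/tensor_piP; exact: tc_Dr.
- by apply/esym; exact: (tensor_scale_pi k [:: (u, v)]).
- apply/esym; apply: etrans (tensor_scale_pi k [:: (u, v)]) _.
  by apply/tensor_piP; exact: tc_Z.
Qed.

Lemma tensor_ind U V (P : tensor U V -> Prop) :
  P 0 -> (forall x y, P x -> P y -> P (x + y)) -> (forall u v, P (u ⊗ v)) ->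
  forall x, P x.
Proof.
move=> P0 PD Pt; elim/quotW; elim=> [//|[u v] s ih].
have -> : \pi_(tensor U V) ((u, v) :: s) = u ⊗ v + \pi_(tensor U V) s.
  by rewrite [RHS]tensorD_pi.
exact: PD.
Qed.

Lemma tensor_eq U V W (f g : tensor U V -> W) :
  linear f -> linear g -> (forall u v, f (u ⊗ v) = g (u ⊗ v)) -> f =1 g.
Proof.
have addlin (h : tensor U V -> W) : linear h ->
    h 0 = 0 /\ forall x y, h (x + y) = h x + h y.
  move=> lh; have hD x y : h (x + y) = h x + h y.
    by have := lh 1%R x y; rewrite !scale1r.
  by split=> //; apply: (addrI (h 0)); rewrite -hD !addr0.
move=> /addlin[f0 fD] /addlin[g0 gD] h; elim/tensor_ind => [|x y hx hy|u v] //.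
  by rewrite f0 g0.
by rewrite fD gD hx hy.
Qed.


(* [tensor_lift] is also linear in the map being extended. *)
Lemma tensor_lift_addf U V W (f g : U -> V -> W) x :
  tensor_lift (fun u v => f u v + g u v) x = tensor_lift f x + tensor_lift g x.
Proof. by rewrite /tensor_lift big_split. Qed.

Lemma tensor_lift_scalef U V W k (f : U -> V -> W) x :
  tensor_lift (fun u v => k *: f u v) x = k *: tensor_lift f x.
Proof. by rewrite /tensor_lift scaler_sumr. Qed.

Lemma eq_tensor_lift U V W (f g : U -> V -> W) : f =2 g -> tensor_lift f =1 tensor_lift g.
Proof. by move=> fg x; apply: eq_bigr => p _; exact: fg. Qed.

Lemma tensor_lift_lin U V W (f : U -> V -> W) (hf : bilin f) k x y :
  tensor_lift f (k *: x + y) = k *: tensor_lift f x + tensor_lift f y.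
Proof. exact: tensor_lift_is_linear. Qed.

(* f ⊗ g for linear maps f and g *)
Definition tmap U V U' V' (f : U -> U') (g : V -> V')
    (x : tensor U V) : tensor U' V' :=
  tensor_lift (fun u v => f u ⊗ g v) x.

Lemma linear_D U V (f : U -> V) : linear f -> forall x y, f (x + y) = f x + f y.
Proof. by move=> hf x y; have := hf 1 x y; rewrite !scale1r. Qed.

Lemma linear_0 U V (f : U -> V) : linear f -> f 0 = 0.
Proof. by move=> /linear_D hf; apply: (addrI (f 0)); rewrite -hf !addr0. Qed.

Lemma linear_Z U V (f : U -> V) : linear f -> forall k x, f (k *: x) = k *: f x.
Proof.
by move=> hf k x; have := hf k x 0; rewrite !addr0 (linear_0 hf) addr0.
Qed.

Lemma tensDl U V (u u' : U) (v : V) : (u + u') ⊗ v = u ⊗ v + u' ⊗ v.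
Proof. exact: (bilinDl (tens_bilin U V)). Qed.
Lemma tensDr U V (u : U) (v v' : V) : u ⊗ (v + v') = u ⊗ v + u ⊗ v'.
Proof. exact: (bilinDr (tens_bilin U V)). Qed.
Lemma tensZl U V k (u : U) (v : V) : (k *: u) ⊗ v = k *: (u ⊗ v).
Proof. exact: (bilinZl (tens_bilin U V)). Qed.
Lemma tensZr U V k (u : U) (v : V) : u ⊗ (k *: v) = k *: (u ⊗ v).
Proof. exact: (bilinZr (tens_bilin U V)). Qed.

Section Tmap.
Context U V U' V' (f : U -> U') (g : V -> V').
Hypotheses (hf : linear f) (hg : linear g).

Lemma tmap_bilin : bilin (fun u v => f u ⊗ g v).
Proof.
apply: bilinP => [u u' v|u v v'|k u v|k u v].
- by rewrite (linear_D hf) tensDl.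
- by rewrite (linear_D hg) tensDr.
- by rewrite (linear_Z hf) tensZl.
- by rewrite (linear_Z hg) tensZr.
Qed.

Lemma tmap_tens u v : tmap f g (u ⊗ v) = f u ⊗ g v.
Proof. by rewrite /tmap (tensor_lift_tens tmap_bilin). Qed.

Lemma tmap_linear : linear (tmap f g).
Proof. exact: (tensor_lift_is_linear tmap_bilin). Qed.

End Tmap.

Section Assoc.
Context U V W.

Definition assoc (x : tensor (tensor U V) W) : tensor U (tensor V W) :=
  tensor_lift (fun y w => tensor_lift (fun u v => u ⊗ (v ⊗ w)) y) x.
Definition assoc_inv (x : tensor U (tensor V W)) : tensor (tensor U V) W :=
  tensor_lift (fun u y => tensor_lift (fun v w => (u ⊗ v) ⊗ w) y) x.

Let bin w : bilin (fun (u : U) (v : V) => u ⊗ (v ⊗ (w : W))).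
Proof.
by apply: bilinP => *; rewrite ?(tensDl, tensDr, tensZl, tensZr).
Qed.

Let bin' u : bilin (fun (v : V) (w : W) => (u : U) ⊗ v ⊗ w).
Proof.
by apply: bilinP => *; rewrite ?(tensDl, tensDr, tensZl, tensZr).
Qed.

Let bout : bilin (fun (y : tensor U V) (w : W) => tensor_lift (fun u v => u ⊗ (v ⊗ w)) y).
Proof.
apply: bilinP => [y y' w|y w w'|k y w|k y w].
- exact: (tensor_liftD (bin w)).
- by rewrite -tensor_lift_addf; apply: eq_tensor_lift => u v; rewrite !tensDr.
- exact: (tensor_liftZ (bin w)).
- by rewrite -tensor_lift_scalef; apply: eq_tensor_lift => u v; rewrite !tensZr.
Qed.

Let bout' : bilin (fun (u : U) (y : tensor V W) => tensor_lift (fun v w => u ⊗ v ⊗ w) y).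
Proof.
apply: bilinP => [u u' y|u y y'|k u y|k u y].
- by rewrite -tensor_lift_addf; apply: eq_tensor_lift => v w; rewrite !tensDl.
- exact: (tensor_liftD (bin' u)).
- by rewrite -tensor_lift_scalef; apply: eq_tensor_lift => v w; rewrite !tensZl.
- exact: (tensor_liftZ (bin' u)).
Qed.

Lemma assoc_linear : linear assoc.
Proof. exact: (tensor_lift_is_linear bout). Qed.
Lemma assoc_inv_linear : linear assoc_inv.
Proof. exact: (tensor_lift_is_linear bout'). Qed.

Lemma assoc_tens u v w : assoc (u ⊗ v ⊗ w) = u ⊗ (v ⊗ w).
Proof. by rewrite /assoc (tensor_lift_tens bout) (tensor_lift_tens (bin w)). Qed.
Lemma assoc_inv_tens u v w : assoc_inv (u ⊗ (v ⊗ w)) = u ⊗ v ⊗ w.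
Proof. by rewrite /assoc_inv (tensor_lift_tens bout') (tensor_lift_tens (bin' u)). Qed.

Lemma tensor_ind3 (P : tensor (tensor U V) W -> Prop) :
  P 0 -> (forall x y, P x -> P y -> P (x + y)) ->
  (forall u v w, P (u ⊗ v ⊗ w)) -> forall x, P x.
Proof.
move=> P0 PD Pt; elim/tensor_ind => // x w; elim/tensor_ind: x => //.
  by rewrite (bilin0l (tens_bilin _ _)).
by move=> x y hx hy; rewrite tensDl; exact: PD.
Qed.

Lemma tensor_ind3r (P : tensor U (tensor V W) -> Prop) :
  P 0 -> (forall x y, P x -> P y -> P (x + y)) ->
  (forall u v w, P (u ⊗ (v ⊗ w))) -> forall x, P x.
Proof.
move=> P0 PD Pt; elim/tensor_ind => // u x; elim/tensor_ind: x => //.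
  by rewrite (bilin0r (tens_bilin _ _)).
by move=> x y hx hy; rewrite tensDr; exact: PD.
Qed.

Lemma assocK : cancel assoc assoc_inv.
Proof.
elim/tensor_ind3 => [|x y hx hy|u v w].
- by rewrite (linear_0 assoc_linear) (linear_0 assoc_inv_linear).
- by rewrite (linear_D assoc_linear) (linear_D assoc_inv_linear) hx hy.
- by rewrite assoc_tens assoc_inv_tens.
Qed.

Lemma assoc_invK : cancel assoc_inv assoc.
Proof.
elim/tensor_ind3r => [|x y hx hy|u v w].
- by rewrite (linear_0 assoc_inv_linear) (linear_0 assoc_linear).
- by rewrite (linear_D assoc_inv_linear) (linear_D assoc_linear) hx hy.
- by rewrite assoc_inv_tens assoc_tens.
Qed.

End Assoc.

End TensorTheory.

Section NuAlgebraTheory.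
Context {K : fieldType} (A : nuAlgType K).
Implicit Types a b : A.

Lemma nu_mul0l a : 0 · a = 0.
Proof. by apply: (addrI (0 · a)); rewrite -nu_mulDl !addr0. Qed.
Lemma nu_mul0r a : a · 0 = 0.
Proof. by apply: (addrI (a · 0)); rewrite -nu_mulDr !addr0. Qed.

End NuAlgebraTheory.

Section TensorAlgebra.
Context {K : fieldType} (A B : nuAlgType K).
Implicit Types x y z : tensor A B.

Definition tensor_mul x y : tensor A B :=
  tensor_lift (fun a b => tensor_lift (fun c d => (a · c) ⊗ (b · d)) y) x.

Let bin a b : bilin (fun (c : A) (d : B) => ((a : A) · c) ⊗ ((b : B) · d)).
Proof.
apply: bilinP => *.
- by rewrite nu_mulDr tensDl.
- by rewrite nu_mulDr tensDr.
- by rewrite nu_mulZr tensZl.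
- by rewrite nu_mulZr tensZr.
Qed.

Let bout y :
  bilin (fun (a : A) (b : B) => tensor_lift (fun c d => (a · c) ⊗ (b · d)) y).
Proof.
apply: bilinP => *.
- by rewrite -tensor_lift_addf; apply: eq_tensor_lift => c d; rewrite nu_mulDl tensDl.
- by rewrite -tensor_lift_addf; apply: eq_tensor_lift => c d; rewrite nu_mulDl tensDr.
- by rewrite -tensor_lift_scalef; apply: eq_tensor_lift => c d; rewrite nu_mulZl tensZl.
- by rewrite -tensor_lift_scalef; apply: eq_tensor_lift => c d; rewrite nu_mulZl tensZr.
Qed.

Fact tensor_mulDl x y z :
  tensor_mul (x + y) z = tensor_mul x z + tensor_mul y z.
Proof. exact: (tensor_liftD (bout z)). Qed.

Fact tensor_mulDr x y z :
  tensor_mul x (y + z) = tensor_mul x y + tensor_mul x z.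
Proof.
by rewrite -tensor_lift_addf; apply: eq_tensor_lift => a b; exact: (tensor_liftD (bin a b)).
Qed.

Fact tensor_mulZl k x y : tensor_mul (k *: x) y = k *: tensor_mul x y.
Proof. exact: (tensor_liftZ (bout y)). Qed.

Fact tensor_mulZr k x y : tensor_mul x (k *: y) = k *: tensor_mul x y.
Proof.
by rewrite -tensor_lift_scalef; apply: eq_tensor_lift => a b; exact: (tensor_liftZ (bin a b)).
Qed.

Fact tensor_mul_tens (a c : A) (b d : B) :
  tensor_mul (a ⊗ b) (c ⊗ d) = (a · c) ⊗ (b · d).
Proof. by rewrite /tensor_mul (tensor_lift_tens (bout _)) (tensor_lift_tens (bin a b)). Qed.

Fact tensor_mul0l x : tensor_mul 0 x = 0.
Proof. exact: (tensor_lift0 (bout x)). Qed.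

Fact tensor_mul0r x : tensor_mul x 0 = 0.
Proof. by rewrite -(scale0r 0) tensor_mulZr !scale0r. Qed.

Fact tensor_mulA : associative tensor_mul.
Proof.
move=> x y z; elim/(@tensor_ind K A B): x => [|x x' h h'|a b].
- by rewrite !tensor_mul0l.
- by rewrite !tensor_mulDl h h'.
elim/(@tensor_ind K A B): y => [|y y' h h'|c d].
- by rewrite !(tensor_mul0l, tensor_mul0r).
- by rewrite !(tensor_mulDl, tensor_mulDr) h h'.
elim/(@tensor_ind K A B): z => [|z z' h h'|e f].
- by rewrite !tensor_mul0r.
- by rewrite !tensor_mulDr h h'.
by rewrite !tensor_mul_tens !mulgA.
Qed.

HB.instance Definition _ := isSemigroup.Build (tensor A B) tensor_mulA.
HB.instance Definition _ := Lmodule_Semigroup_isNuAlgebra.Build K (tensor A B)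
  tensor_mulDl tensor_mulDr tensor_mulZl tensor_mulZr.

Lemma tensM (a c : A) (b d : B) : (a ⊗ b) · (c ⊗ d) = (a · c) ⊗ (b · d).
Proof. exact: tensor_mul_tens. Qed.

End TensorAlgebra.

Section MultiplierDef.
Context {K : fieldType} (A : nuAlgType K).

(* Double centralizers (L, R), with L a = m a and R a = a m for the multiplier m *)
Definition double_centralizer (p : (A -> A) * (A -> A)) : Prop :=
  [/\ linear p.1, linear p.2,
      forall a b, p.1 (a · b) = p.1 a · b,
      forall a b, p.2 (a · b) = a · p.2 b &
      forall a b, a · p.1 b = p.2 a · b].

Definition double_centralizers : {pred (A -> A) * (A -> A)} :=
  fun p => `[< double_centralizer p >].

Fact double_centralizers_submod : submod_closed double_centralizers.
Proof.
split=> [|k p q].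
  apply/asboolP; split=> /= [k a b|k a b|a b|a b|a b] /=;
    rewrite ?scaler0 ?addr0 ?nu_mul0l ?nu_mul0r //.
move=> /asboolP[h1 h2 h3 h4 h5] /asboolP[g1 g2 g3 g4 g5].
have E1 a : (k *: p + q).1 a = k *: p.1 a + q.1 a by [].
have E2 a : (k *: p + q).2 a = k *: p.2 a + q.2 a by [].
apply/asboolP; split=> [l a b|l a b|a b|a b|a b].
- by rewrite !E1 h1 g1 !scalerDr !scalerA (mulrC k) addrACA.
- by rewrite !E2 h2 g2 !scalerDr !scalerA (mulrC k) addrACA.
- by rewrite !E1 h3 g3 nu_mulDl nu_mulZl.
- by rewrite !E2 h4 g4 nu_mulDr nu_mulZr.
- by rewrite E1 E2 nu_mulDr nu_mulDl nu_mulZr nu_mulZl h5 g5.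
Qed.

HB.instance Definition _ := GRing.isSubmodClosed.Build K _
  double_centralizers double_centralizers_submod.

Record multiplier := Multiplier {
  multiplier_val : (A -> A) * (A -> A) ;
  _ : multiplier_val \in double_centralizers
}.

HB.instance Definition _ := [isSub for multiplier_val].
HB.instance Definition _ := [Choice of multiplier by <:].
HB.instance Definition _ := [SubChoice_isSubLmodule of multiplier by <:].

End MultiplierDef.

Section MultiplierTheory.
Context {K : fieldType} {A : nuAlgType K}.
Implicit Types (m n : multiplier A) (a b : A).

Definition lmul m : A -> A := (val m).1.
Definition rmul m : A -> A := (val m).2.

Lemma multiplierP m : double_centralizer (val m).
Proof. by apply/asboolP; exact: (valP m). Qed.

Lemma lmul_linear m : linear (lmul m).
Proof. by have [h _ _ _ _] := multiplierP m; exact: h. Qed.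
Lemma rmul_linear m : linear (rmul m).
Proof. by have [_ h _ _ _] := multiplierP m; exact: h. Qed.
Lemma lmulM m a b : lmul m (a · b) = lmul m a · b.
Proof. have [_ _ h _ _] := multiplierP m; exact: h. Qed.
Lemma rmulM m a b : rmul m (a · b) = a · rmul m b.
Proof. have [_ _ _ h _] := multiplierP m; exact: h. Qed.
Lemma lrmul m a b : a · lmul m b = rmul m a · b.
Proof. have [_ _ _ _ h] := multiplierP m; exact: h. Qed.

Lemma multiplier_eq m n : lmul m =1 lmul n -> rmul m =1 rmul n -> m = n.
Proof.
move=> hl hr; apply: val_inj; rewrite [LHS]surjective_pairing [RHS]surjective_pairing.
by congr pair; apply: funext.
Qed.

Definition mk_multiplier (p : (A -> A) * (A -> A)) (hp : double_centralizer p) :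
  multiplier A := Multiplier (asboolT hp).

Fact emb_proof a : double_centralizer (fun b => a · b, fun b => b · a).
Proof.
split=> /= [k b c|k b c|b c|b c|b c]; rewrite ?mulgA //.
- by rewrite nu_mulDr nu_mulZr.
- by rewrite nu_mulDl nu_mulZl.
Qed.

Definition emb a : multiplier A := mk_multiplier (emb_proof a).

Fact mult_one_proof : @double_centralizer K A (id, id).
Proof. by split. Qed.

Definition mult_one : multiplier A := mk_multiplier mult_one_proof.

Fact mult_mul_proof m n :
  double_centralizer (fun a => lmul m (lmul n a), fun a => rmul n (rmul m a)).
Proof.
split=> /= [k a b|k a b|a b|a b|a b].
- by rewrite !lmul_linear.
- by rewrite !rmul_linear.
- by rewrite !lmulM.
- by rewrite !rmulM.
- by rewrite !lrmul.
Qed.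

Definition mult_mul m n : multiplier A := mk_multiplier (mult_mul_proof m n).

Fact mult_mulA : associative mult_mul.
Proof. by move=> m n p; apply: multiplier_eq. Qed.
Fact mult_mul1l : left_id mult_one mult_mul.
Proof. by move=> m; apply: multiplier_eq. Qed.
Fact mult_mul1r : right_id mult_one mult_mul.
Proof. by move=> m; apply: multiplier_eq. Qed.

HB.instance Definition _ :=
  isMonoid.Build (multiplier A) mult_mulA mult_mul1l mult_mul1r.

Lemma lmulD m n a : lmul (m + n) a = lmul m a + lmul n a. Proof. by []. Qed.
Lemma rmulD m n a : rmul (m + n) a = rmul m a + rmul n a. Proof. by []. Qed.
Lemma lmulZ k m a : lmul (k *: m) a = k *: lmul m a. Proof. by []. Qed.
Lemma rmulZ k m a : rmul (k *: m) a = k *: rmul m a. Proof. by []. Qed.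

Fact mult_mulDl m n p : (m + n) · p = m · p + n · p.
Proof.
apply: multiplier_eq => a //.
by rewrite [LHS](linear_D (rmul_linear p)).
Qed.
Fact mult_mulDr m n p : m · (n + p) = m · n + m · p.
Proof.
apply: multiplier_eq => a //.
by rewrite [LHS](linear_D (lmul_linear m)).
Qed.
Fact mult_mulZl k m n : (k *: m) · n = k *: (m · n).
Proof.
apply: multiplier_eq => a //.
by rewrite [LHS](linear_Z (rmul_linear n)).
Qed.
Fact mult_mulZr k m n : m · (k *: n) = k *: (m · n).
Proof.
apply: multiplier_eq => a //.
by rewrite [LHS](linear_Z (lmul_linear m)).
Qed.

HB.instance Definition _ := Lmodule_Semigroup_isNuAlgebra.Build K (multiplier A)
  mult_mulDl mult_mulDr mult_mulZl mult_mulZr.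

Lemma emb_linear : linear emb.
Proof.
move=> k a b; apply: multiplier_eq => c.
  by rewrite lmulD lmulZ; rewrite /lmul /= nu_mulDl nu_mulZl.
by rewrite rmulD rmulZ; rewrite /rmul /= nu_mulDr nu_mulZr.
Qed.

Lemma embM a b : emb (a · b) = emb a · emb b.
Proof.
apply: multiplier_eq => c; first by rewrite /lmul /= -mulgA.
by rewrite /rmul /= mulgA.
Qed.

Lemma emb_inj : nondegenerate_algebra A -> injective emb.
Proof.
move=> [ndA _] a b /(congr1 lmul) eab; apply/eqP; rewrite -subr_eq0; apply/eqP.
apply: ndA => c; rewrite nu_mulDl -scaleN1r nu_mulZl scaleN1r.
by move/(congr1 (@^~ c)): eab; rewrite /lmul /= => ->; rewrite subrr.
Qed.

End MultiplierTheory.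

Section TensorMultiplier.
Context {K : fieldType} {A B : nuAlgType K}.

Fact mtens_proof (m : multiplier A) (n : multiplier B) :
  double_centralizer (tmap (lmul m) (lmul n), tmap (rmul m) (rmul n)).
Proof.
have lmn := tmap_linear (lmul_linear m) (lmul_linear n).
have rmn := tmap_linear (rmul_linear m) (rmul_linear n).
split=> //= x y.
- elim/(@tensor_ind K A B): x => [|x x' h h'|a b].
  + by rewrite nu_mul0l (linear_0 lmn) nu_mul0l.
  + by rewrite nu_mulDl !(linear_D lmn) nu_mulDl h h'.
  elim/(@tensor_ind K A B): y => [|y y' h h'|c d].
  + by rewrite !nu_mul0r (linear_0 lmn).
  + by rewrite !nu_mulDr !(linear_D lmn) h h'.
  by rewrite tensM !(tmap_tens (lmul_linear m) (lmul_linear n)) tensM !lmulM.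
- elim/(@tensor_ind K A B): x => [|x x' h h'|a b].
  + by rewrite !nu_mul0l (linear_0 rmn).
  + by rewrite !nu_mulDl !(linear_D rmn) h h'.
  elim/(@tensor_ind K A B): y => [|y y' h h'|c d].
  + by rewrite nu_mul0r (linear_0 rmn) nu_mul0r.
  + by rewrite nu_mulDr !(linear_D rmn) nu_mulDr h h'.
  by rewrite tensM !(tmap_tens (rmul_linear m) (rmul_linear n)) tensM !rmulM.
- elim/(@tensor_ind K A B): x => [|x x' h h'|a b].
  + by rewrite (linear_0 rmn) !nu_mul0l.
  + by rewrite (linear_D rmn) !nu_mulDl h h'.
  elim/(@tensor_ind K A B): y => [|y y' h h'|c d].
  + by rewrite (linear_0 lmn) !nu_mul0r.
  + by rewrite (linear_D lmn) !nu_mulDr h h'.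
  rewrite (tmap_tens (rmul_linear m) (rmul_linear n)).
  by rewrite (tmap_tens (lmul_linear m) (lmul_linear n)) !tensM !lrmul.
Qed.

(* m ⊗ n as a multiplier of A ⊗ B *)
Definition mtens (m : multiplier A) (n : multiplier B) :
  multiplier (tensor A B) := mk_multiplier (mtens_proof m n).

Lemma lmul_mtens m n a b : lmul (mtens m n) (a ⊗ b) = lmul m a ⊗ lmul n b.
Proof. exact: (tmap_tens (lmul_linear m) (lmul_linear n)). Qed.
Lemma rmul_mtens m n a b : rmul (mtens m n) (a ⊗ b) = rmul m a ⊗ rmul n b.
Proof. exact: (tmap_tens (rmul_linear m) (rmul_linear n)). Qed.

Lemma mtens_bilin : bilin mtens.
Proof.
apply: bilinP => [m m' n|m n n'|k m n|k m n]; apply: multiplier_eq;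
  apply: tensor_eq; try exact: lmul_linear; try exact: rmul_linear;
  move=> a b; rewrite ?(lmulD, rmulD, lmulZ, rmulZ, lmul_mtens, rmul_mtens).
all: by rewrite ?(tensDl, tensDr, tensZl, tensZr).
Qed.

Lemma emb_tens (a : A) (b : B) : emb (a ⊗ b) = mtens (emb a) (emb b).
Proof.
apply: multiplier_eq; apply: tensor_eq;
  try exact: lmul_linear; try exact: rmul_linear; move=> c d.
- by rewrite lmul_mtens; exact: tensM.
- by rewrite rmul_mtens; exact: tensM.
Qed.

Lemma mtens1 : mtens 1%g 1%g = 1%g.
Proof.
apply: multiplier_eq; apply: tensor_eq;
  try exact: lmul_linear; try exact: rmul_linear; move=> c d.
- exact: lmul_mtens.
- exact: rmul_mtens.
Qed.

End TensorMultiplier.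

Section AssocMultiplier.
Context {K : fieldType} {A B C : nuAlgType K}.

Lemma assocM (x y : tensor (tensor A B) C) : assoc (x · y) = assoc x · assoc y.
Proof.
have al := @assoc_linear K A B C.
elim/(@tensor_ind3 K A B C): x => [|x x' h h'|a b c].
- by rewrite nu_mul0l (linear_0 al) nu_mul0l.
- by rewrite nu_mulDl !(linear_D al) nu_mulDl h h'.
elim/(@tensor_ind3 K A B C): y => [|y y' h h'|d e f].
- by rewrite nu_mul0r (linear_0 al) nu_mul0r.
- by rewrite nu_mulDr !(linear_D al) nu_mulDr h h'.
by rewrite !tensM !assoc_tens !tensM.
Qed.

Lemma assoc_invM (x y : tensor A (tensor B C)) :
  assoc_inv (x · y) = assoc_inv x · assoc_inv y.
Proof.
by apply: (can_inj (@assocK K A B C)); rewrite assocM !assoc_invK.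
Qed.

Fact massoc_proof (m : multiplier (tensor A (tensor B C))) :
  double_centralizer (fun x : tensor (tensor A B) C => assoc_inv (lmul m (assoc x)),
                      fun x : tensor (tensor A B) C => assoc_inv (rmul m (assoc x))).
Proof.
split=> /= [k x y|k x y|x y|x y|x y].
- by rewrite assoc_linear lmul_linear assoc_inv_linear.
- by rewrite assoc_linear rmul_linear assoc_inv_linear.
- by rewrite assocM lmulM assoc_invM assocK.
- by rewrite assocM rmulM assoc_invM assocK.
- by rewrite -{1}(assocK x) -{2}(assocK y) -!assoc_invM lrmul.
Qed.

(* The identification of M(A ⊗ (B ⊗ C)) with M((A ⊗ B) ⊗ C) *)
Definition massoc (m : multiplier (tensor A (tensor B C))) :
  multiplier (tensor (tensor A B) C) := mk_multiplier (massoc_proof m).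

Lemma massoc_mtens (m : multiplier A) (n : multiplier B) (p : multiplier C) :
  massoc (mtens m (mtens n p)) = mtens (mtens m n) p.
Proof.
apply: multiplier_eq; elim/(@tensor_ind3 K A B C).
- by rewrite !(linear_0 (lmul_linear _)).
- by move=> x y hx hy; rewrite !(linear_D (lmul_linear _)) hx hy.
- move=> a b c; rewrite !lmul_mtens.
  rewrite [LHS](_ : _ = assoc_inv (lmul (mtens m (mtens n p)) (assoc (a ⊗ b ⊗ c)))) //.
  by rewrite assoc_tens !lmul_mtens assoc_inv_tens.
- by rewrite !(linear_0 (rmul_linear _)).
- by move=> x y hx hy; rewrite !(linear_D (rmul_linear _)) hx hy.
- move=> a b c; rewrite !rmul_mtens.
  rewrite [LHS](_ : _ = assoc_inv (rmul (mtens m (mtens n p)) (assoc (a ⊗ b ⊗ c)))) //.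
  by rewrite assoc_tens !rmul_mtens assoc_inv_tens.
Qed.

End AssocMultiplier.

Section Coproduct.
Context {K : fieldType} {A : nuAlgType K}.
Variable Delta : {linear A -> multiplier (tensor A A)}.
Implicit Types (a b c : A) (x y z : tensor A A).

(* c ⊗ 1 and 1 ⊗ b in M(A ⊗ A) *)
Definition tens_one c : multiplier (tensor A A) := mtens (emb c) 1%g.
Definition one_tens b : multiplier (tensor A A) := mtens 1%g (emb b).

Definition T1 : tensor A A -> multiplier (tensor A A) :=
  tensor_lift (fun a b => Delta a · one_tens b).
Definition T2 : tensor A A -> multiplier (tensor A A) :=
  tensor_lift (fun c a => tens_one c · Delta a).
Definition T3 : tensor A A -> multiplier (tensor A A) :=
  tensor_lift (fun a b => one_tens b · Delta a).
Definition T4 : tensor A A -> multiplier (tensor A A) :=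
  tensor_lift (fun c a => Delta a · tens_one c).

Definition regular_map (T : tensor A A -> multiplier (tensor A A)) : Prop :=
  forall x, exists y, T x = emb y.

(* The threefold tensor product is taken to be (A ⊗ A) ⊗ A. *)
Definition Delta_id : tensor A A -> multiplier (tensor (tensor A A) A) :=
  tensor_lift (fun a b => mtens (Delta a) (emb b)).
Definition id_Delta : tensor A A -> multiplier (tensor (tensor A A) A) :=
  tensor_lift (fun a b => massoc (mtens (emb a) (Delta b))).

(* In the coassociativity conditions y and z are the elements of A ⊗ A that
   equal the given multipliers; they exist by regularity of the canonical maps. *)
Definition coassoc12 : Prop := forall a b c y z,
  emb y = Delta a · one_tens b -> emb z = tens_one c · Delta a ->
  mtens (tens_one c) 1%g · Delta_id y = id_Delta z · mtens 1%g (emb b).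
Definition coassoc34 : Prop := forall a b c y z,
  emb y = one_tens b · Delta a -> emb z = Delta a · tens_one c ->
  Delta_id y · mtens (tens_one c) 1%g = mtens 1%g (emb b) · id_Delta z.
Definition coassoc14 : Prop := forall a b c y z,
  emb y = Delta a · one_tens b -> emb z = Delta a · tens_one c ->
  Delta_id y · mtens (tens_one c) 1%g = id_Delta z · mtens 1%g (emb b).
Definition coassoc23 : Prop := forall a b c y z,
  emb y = one_tens b · Delta a -> emb z = tens_one c · Delta a ->
  mtens (tens_one c) 1%g · Delta_id y = mtens 1%g (emb b) · id_Delta z.

Definition is_coproduct : Prop :=
  (forall a b, Delta (a · b) = Delta a · Delta b) /\
  [\/ [/\ regular_map T1, regular_map T2 & coassoc12],
      [/\ regular_map T3, regular_map T4 & coassoc34],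
      [/\ regular_map T1, regular_map T4 & coassoc14] |
      [/\ regular_map T2, regular_map T3 & coassoc23]].

(* ι ⊗ φ and ψ ⊗ ι on A ⊗ A *)
Definition id_slice (phi : A -> K) : tensor A A -> A :=
  tensor_lift (fun a b => phi b *: a).
Definition slice_id (psi : A -> K) : tensor A A -> A :=
  tensor_lift (fun a b => psi a *: b).

Definition left_integral (phi : {scalar A}) : Prop :=
  [/\ regular_map T2 \/ regular_map T4,
      exists a, phi a != 0 &
      forall a c c' y, emb y = tens_one c · Delta a · tens_one c' ->
        id_slice phi y = phi a *: (c · c')].

Definition right_integral (psi : {scalar A}) : Prop :=
  [/\ regular_map T1 \/ regular_map T3,
      exists a, psi a != 0 &
      forall a b b' y, emb y = one_tens b' · Delta a · one_tens b ->
        slice_id psi y = psi a *: (b' · b)].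

Definition bijective_onto_tensor (T : tensor A A -> multiplier (tensor A A)) : Prop :=
  set_bij [set: tensor A A] (range emb) T.

Definition multiplier_Hopf_algebra : Prop :=
  [/\ nondegenerate_algebra A,
      is_coproduct,
      regular_map T1 /\ regular_map T2,
      bijective_onto_tensor T1 &
      bijective_onto_tensor T2].

Definition regular_multiplier_Hopf_algebra : Prop :=
  [/\ multiplier_Hopf_algebra,
      regular_map T3 /\ regular_map T4,
      bijective_onto_tensor T3 &
      bijective_onto_tensor T4].

End Coproduct.

Section Faithful.
Context {K : fieldType} {A : nuAlgType K}.

Definition left_faithful (omega : {scalar A}) : Prop :=
  forall a, (forall b, omega (a · b) = 0) -> a = 0.
Definition right_faithful (omega : {scalar A}) : Prop :=
  forall a, (forall c, omega (c · a) = 0) -> a = 0.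
Definition faithful_functional (omega : {scalar A}) : Prop :=
  left_faithful omega /\ right_faithful omega.

End Faithful.

Section Bilinearity.
Context {K : fieldType} {A : nuAlgType K}.
Variable Delta : {linear A -> multiplier (tensor A A)}.
Implicit Types (a b c : A).

Lemma tens_one_linear : linear (@tens_one K A).
Proof.
move=> k a b; rewrite /tens_one emb_linear.
by rewrite (bilinDl mtens_bilin) (bilinZl mtens_bilin).
Qed.

Lemma one_tens_linear : linear (@one_tens K A).
Proof.
move=> k a b; rewrite /one_tens emb_linear.
by rewrite (bilinDr mtens_bilin) (bilinZr mtens_bilin).
Qed.

Lemma T1_bilin : bilin (fun a b => Delta a · one_tens b).
Proof.
apply: bilinP => *; rewrite ?(linearD, linearZ, linear_D one_tens_linear,
  linear_Z one_tens_linear) /=; by rewrite ?(nu_mulDl, nu_mulDr, nu_mulZl, nu_mulZr).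
Qed.

Lemma T2_bilin : bilin (fun c a => tens_one c · Delta a).
Proof.
apply: bilinP => *; rewrite ?(linearD, linearZ, linear_D tens_one_linear,
  linear_Z tens_one_linear) /=; by rewrite ?(nu_mulDl, nu_mulDr, nu_mulZl, nu_mulZr).
Qed.

Lemma T3_bilin : bilin (fun a b => one_tens b · Delta a).
Proof.
apply: bilinP => *; rewrite ?(linearD, linearZ, linear_D one_tens_linear,
  linear_Z one_tens_linear) /=; by rewrite ?(nu_mulDl, nu_mulDr, nu_mulZl, nu_mulZr).
Qed.

Lemma T4_bilin : bilin (fun c a => Delta a · tens_one c).
Proof.
apply: bilinP => *; rewrite ?(linearD, linearZ, linear_D tens_one_linear,
  linear_Z tens_one_linear) /=; by rewrite ?(nu_mulDl, nu_mulDr, nu_mulZl, nu_mulZr).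
Qed.

Lemma T1_tens a b : T1 Delta (a ⊗ b) = Delta a · one_tens b.
Proof. exact: (tensor_lift_tens T1_bilin). Qed.
Lemma T2_tens c a : T2 Delta (c ⊗ a) = tens_one c · Delta a.
Proof. exact: (tensor_lift_tens T2_bilin). Qed.
Lemma T3_tens a b : T3 Delta (a ⊗ b) = one_tens b · Delta a.
Proof. exact: (tensor_lift_tens T3_bilin). Qed.
Lemma T4_tens c a : T4 Delta (c ⊗ a) = Delta a · tens_one c.
Proof. exact: (tensor_lift_tens T4_bilin). Qed.

Lemma Delta_id_bilin : bilin (fun a b => mtens (Delta a) (emb b)).
Proof.
apply: bilinP => *; rewrite ?(linearD, linearZ, linear_D emb_linear,
  linear_Z emb_linear) /=.
- by rewrite (bilinDl mtens_bilin).
- by rewrite (bilinDr mtens_bilin).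
- by rewrite (bilinZl mtens_bilin).
- by rewrite (bilinZr mtens_bilin).
Qed.

Lemma massoc_linear (B C D : nuAlgType K) : linear (@massoc K B C D).
Proof.
move=> k m n; apply: multiplier_eq => x.
  rewrite lmulD lmulZ.
  exact: (@assoc_inv_linear K B C D k (lmul m (assoc x)) (lmul n (assoc x))).
rewrite rmulD rmulZ.
exact: (@assoc_inv_linear K B C D k (rmul m (assoc x)) (rmul n (assoc x))).
Qed.

Lemma id_Delta_bilin : bilin (fun a b => massoc (mtens (emb a) (Delta b))).
Proof.
apply: bilinP => *; rewrite ?(linearD, linearZ, linear_D emb_linear,
  linear_Z emb_linear) /=.
- by rewrite (bilinDl mtens_bilin) (linear_D (@massoc_linear _ _ _)).
- by rewrite (bilinDr mtens_bilin) (linear_D (@massoc_linear _ _ _)).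
- by rewrite (bilinZl mtens_bilin) (linear_Z (@massoc_linear _ _ _)).
- by rewrite (bilinZr mtens_bilin) (linear_Z (@massoc_linear _ _ _)).
Qed.

Lemma id_slice_bilin (phi : {scalar A}) : bilin (fun a b => phi b *: a).
Proof.
apply: bilinP => [a a' b|a b b'|k a b|k a b].
- by rewrite scalerDr.
- by rewrite linearD scalerDl.
- by rewrite !scalerA mulrC.
- by rewrite linearZ scalerA.
Qed.

Lemma slice_id_bilin (psi : {scalar A}) : bilin (fun a b => psi a *: b).
Proof.
apply: bilinP => [a a' b|a b b'|k a b|k a b].
- by rewrite linearD scalerDl.
- by rewrite scalerDr.
- by rewrite linearZ scalerA.
- by rewrite !scalerA mulrC.
Qed.

End Bilinearity.

(* Main.v *)
(** By left invariance of phi, in Sweedler notation,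
    [T1 (p1 ⊗ q1 b phi(p2 q2)) = p1 phi(p2 q) ⊗ b], and the argument of T1 makes
    sense when T1 and T4 are regular. Right faithfulness of psi makes T1 injective.
    By left faithfulness of phi, T1 (a ⊗ b) is a sum of elements
    [a1 phi(a2 q) ⊗ y], so injectivity writes a ⊗ b itself as a sum of elements
    [a1 phi(a2 v) ⊗ u]; hence every a is of the form [a1 phi(a2 q)] and T1 is
    surjective. The same holds for T4 with the legs exchanged.
    The inverses give the counit through [eps(a1 phi(a2 q)) = phi(a q)], and left
    multipliers S(a), S^-1(a) through [T1^-1 (a ⊗ b) = a1 ⊗ S(a2) b] and
    [T4^-1 (c ⊗ a) = S^-1(a1) c ⊗ a2]. As S (S^-1(a) c) = S(c) a lies in A, S is a
    bijection of A, and applying S to the first leg of T4^-1 (c ⊗ a) gives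
    (S(c) ⊗ 1) Delta(a): so T2, and likewise T3, is regular and bijective.
    The pair (T2, T3) is the pair (T4, T1) of the opposite algebra. *)
Require Import Defs.
From mathcomp Require Import all_boot all_order all_algebra reals complex.
From mathcomp Require Import boolp.
From HB Require Import structures.
Set Implicit Arguments.
Unset Strict Implicit.
Unset Printing Implicit Defensive.
Import GRing.Theory.
Local Open Scope ring_scope.
Local Open Scope mhopf_scope.

(** * Linear maps on tensor products *)

Section BundledMaps.
Context {K : fieldType}.

HB.instance Definition _ (U V U' V' : lmodType K) (f : {linear U -> U'})
    (g : {linear V -> V'}) :=
  GRing.isLinear.Build K (tensor U V) (tensor U' V') *:%R (tmap f g)
    (tmap_linear (linearP f) (linearP g)).

HB.instance Definition _ (U V W : lmodType K) :=
  GRing.isLinear.Build K (tensor (tensor U V) W) (tensor U (tensor V W)) *:%R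
    (@assoc K U V W) (@assoc_linear K U V W).
HB.instance Definition _ (U V W : lmodType K) :=
  GRing.isLinear.Build K (tensor U (tensor V W)) (tensor (tensor U V) W) *:%R
    (@assoc_inv K U V W) (@assoc_inv_linear K U V W).

Definition swap {U V : lmodType K} : tensor U V -> tensor V U :=
  tensor_lift (fun u v => v ⊗ u).

Fact swap_bilin (U V : lmodType K) : bilin (fun (u : U) (v : V) => v ⊗ u).
Proof. by apply: bilinP => *; rewrite ?(tensDl, tensDr, tensZl, tensZr). Qed.

HB.instance Definition _ (U V : lmodType K) :=
  GRing.isLinear.Build K (tensor U V) (tensor V U) *:%R (@swap U V)
    (tensor_lift_is_linear (swap_bilin U V)).

Definition rslice (U V : lmodType K) (f : V -> K) : tensor U V -> U :=
  tensor_lift (fun u v => f v *: u).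
Definition lslice (U V : lmodType K) (f : U -> K) : tensor U V -> V :=
  tensor_lift (fun u v => f u *: v).

Fact rslice_bilin (U V : lmodType K) (f : {scalar V}) :
  bilin (fun (u : U) (v : V) => f v *: u).
Proof.
apply: bilinP => *; first by rewrite scalerDr.
- by rewrite linearD scalerDl.
- by rewrite !scalerA mulrC.
- by rewrite linearZ scalerA.
Qed.
Fact lslice_bilin (U V : lmodType K) (f : {scalar U}) :
  bilin (fun (u : U) (v : V) => f u *: v).
Proof.
apply: bilinP => *; first by rewrite linearD scalerDl.
- by rewrite scalerDr.
- by rewrite linearZ scalerA.
- by rewrite !scalerA mulrC.
Qed.

HB.instance Definition _ (U V : lmodType K) (f : {scalar V}) :=
  GRing.isLinear.Build K (tensor U V) U *:%R (rslice f)
    (tensor_lift_is_linear (rslice_bilin U f)).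
HB.instance Definition _ (U V : lmodType K) (f : {scalar U}) :=
  GRing.isLinear.Build K (tensor U V) V *:%R (lslice f)
    (tensor_lift_is_linear (lslice_bilin V f)).

Lemma tmapE (U V U' V' : lmodType K) (f : {linear U -> U'}) (g : {linear V -> V'}) u v :
  tmap f g (u ⊗ v) = f u ⊗ g v.
Proof. exact: (tmap_tens (linearP f) (linearP g)). Qed.
Lemma swapE (U V : lmodType K) (u : U) (v : V) : swap (u ⊗ v) = v ⊗ u.
Proof. exact: (tensor_lift_tens (swap_bilin U V)). Qed.
Lemma rsliceE (U V : lmodType K) (f : {scalar V}) (u : U) v : rslice f (u ⊗ v) = f v *: u.
Proof. exact: (tensor_lift_tens (rslice_bilin U f)). Qed.
Lemma lsliceE (U V : lmodType K) (f : {scalar U}) u (v : V) : lslice f (u ⊗ v) = f u *: v.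
Proof. exact: (tensor_lift_tens (lslice_bilin V f)). Qed.

Lemma linear_tensor_eq (U V W : lmodType K) (f g : {linear tensor U V -> W}) :
  (forall u v, f (u ⊗ v) = g (u ⊗ v)) -> f =1 g.
Proof. by apply: tensor_eq; exact: linearP. Qed.

Lemma swapK (U V : lmodType K) (t : tensor U V) : swap (swap t) = t.
Proof.
elim/(@tensor_ind K U V): t => [|t t' h h'|u v]; first by rewrite !linear0.
  by rewrite !linearD /= h h'.
by rewrite !swapE.
Qed.

End BundledMaps.

Section NuMul.
Context {K : fieldType} {A : nuAlgType K}.

Definition nu_lmul (c : A) : A -> A := fun a => c · a.
Definition nu_rmul (c : A) : A -> A := fun a => a · c.
Fact nu_lmul_linear c : linear (nu_lmul c).
Proof. by move=> k a b; rewrite /nu_lmul nu_mulDr nu_mulZr. Qed.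
Fact nu_rmul_linear c : linear (nu_rmul c).
Proof. by move=> k a b; rewrite /nu_rmul nu_mulDl nu_mulZl. Qed.
HB.instance Definition _ c :=
  GRing.isLinear.Build K A A *:%R (nu_lmul c) (nu_lmul_linear c).
HB.instance Definition _ c :=
  GRing.isLinear.Build K A A *:%R (nu_rmul c) (nu_rmul_linear c).

Fact nu_mult_bilin : bilin (fun a b : A => a · b).
Proof.
by apply: bilinP => *; rewrite ?(nu_mulDl, nu_mulDr, nu_mulZl, nu_mulZr).
Qed.
Definition nu_mult : tensor A A -> A := tensor_lift (fun a b => a · b).
HB.instance Definition _ :=
  GRing.isLinear.Build K (tensor A A) A *:%R nu_mult
    (tensor_lift_is_linear nu_mult_bilin).
Lemma nu_multE a b : nu_mult (a ⊗ b) = a · b.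
Proof. exact: (tensor_lift_tens nu_mult_bilin). Qed.

Lemma nondegenerate_injl (a b : A) : nondegenerate_algebra A ->
  (forall c, a · c = b · c) -> a = b.
Proof.
move=> [nd _] h; apply/eqP; rewrite -subr_eq0; apply/eqP; apply: nd => c.
by rewrite nu_mulDl h -nu_mulDl subrr nu_mul0l.
Qed.

Lemma nondegenerate_injr (a b : A) : nondegenerate_algebra A ->
  (forall c, c · a = c · b) -> a = b.
Proof.
move=> [_ nd] h; apply/eqP; rewrite -subr_eq0; apply/eqP; apply: nd => c.
by rewrite nu_mulDr h -nu_mulDr subrr nu_mul0r.
Qed.

End NuMul.

(** * Slices of tensors and separating families of functionals *)

Section Separation.
Context {K : fieldType}.

(* If x fails to be fixed by F, correct F by the rank one operator
   y |-> (w i (y - F y) / w i d) d with d = x - F x and w i d != 0. *)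
Lemma finite_rank_identity (V : lmodType K) (I : Type) (w : I -> {scalar V}) :
  (forall y, (forall i, w i y = 0) -> y = 0) ->
  forall s : seq V, exists r : seq (I * V),
    {in s, forall y, \sum_(p <- r) w p.1 y *: p.2 = y}.
Proof.
move=> sep; elim=> [|x s [r hr]]; first by exists [::].
pose F y := \sum_(p <- r) w p.1 y *: p.2; pose d := x - F x.
have [d0|/eqP dn0] := eqVneq d 0.
  exists r => y; rewrite inE => /predU1P[->|/hr //].
  by apply/esym/eqP; rewrite -subr_eq0; apply/eqP.
have [i wi] : exists i, w i d != 0.
  apply: contrapT => h; apply: dn0; apply: sep => i.
  by apply/eqP/negP => /negP ni; apply: h; exists i.
pose r' := [seq (p.1, p.2 - (w i p.2 / w i d) *: d) | p <- r].
exists ((i, (w i d)^-1 *: d) :: r') => y ys.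
rewrite big_cons big_map /=.
have -> : \sum_(p <- r) w p.1 y *: (p.2 - (w i p.2 / w i d) *: d) =
    F y - (w i (F y) / w i d) *: d.
  rewrite /F linear_sum mulr_suml scaler_suml -sumrB; apply: eq_bigr => p _.
  by rewrite scalerBr scalerA (linearZ_LR (w i)) /= mulrA.
rewrite scalerA addrCA -scalerBl -mulrBl -linearB /=.
move: ys; rewrite inE => /predU1P[->|ys].
  by rewrite -/d divff // scale1r addrC subrK.
have -> : F y = y by apply: hr.
by rewrite subrr linear0 mul0r scale0r addr0.
Qed.

(** The list [s] collects the second legs in some expression of [t] as a sum of simple tensors. *)
Lemma tensor_finite_support (U V : lmodType K) (t : tensor U V) :
  exists s : seq V, forall F : {linear V -> V}, {in s, F =1 id} ->
    tmap idfun F t = t.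
Proof.
elim/(@tensor_ind K U V): t => [|t t' [s h] [s' h']|u v].
- by exists [::] => F _; rewrite linear0.
- exists (s ++ s') => F hF; rewrite linearD /= h ?h' // => y ys;
    by apply: hF; rewrite mem_cat ys ?orbT.
- by exists [:: v] => F hF; rewrite tmapE /= hF ?mem_seq1.
Qed.

(** A finite rank operator F built from the [w i] fixes the second legs of [t], so [t] equals (id ⊗
    F) [t]; writing out F gives the sum. This replaces the choice of a basis of V. *)
Lemma rslice_expansion (U V : lmodType K) (I : Type) (w : I -> {scalar V})
    (t : tensor U V) :
  (forall y, (forall i, w i y = 0) -> y = 0) ->
  exists r : seq (I * V), t = \sum_(p <- r) rslice (w p.1) t ⊗ p.2.
Proof.
move=> sep; have [s hs] := tensor_finite_support t.
have [r hr] := finite_rank_identity sep s; exists r.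
have F_linear : linear (fun y => \sum_(p <- r) w p.1 y *: p.2).
  move=> k x y; rewrite scaler_sumr -big_split; apply: eq_bigr => p _.
  by rewrite linearP scalerDl scalerA.
pose F : {linear V -> V} := HB.pack (fun y => \sum_(p <- r) w p.1 y *: p.2)
  (GRing.isLinear.Build K V V *:%R _ F_linear).
rewrite -[LHS](hs F) => [|y /hr //].
elim/(@tensor_ind K U V): t {hs} => [|x y hx hy|u v].
- by rewrite linear0 big1 // => p _; rewrite linear0 (bilin0l (tens_bilin _ _)).
- rewrite linearD /= hx hy -big_split; apply: eq_bigr => p _.
  by rewrite linearD tensDl.
- rewrite tmapE /= (big_morph _ (tensDr u) (bilin0r (tens_bilin U V) u)).
  by apply: eq_bigr => p _; rewrite rsliceE tensZl tensZr.
Qed.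

Lemma rslice_separates (U V : lmodType K) (I : Type) (w : I -> {scalar V})
    (t t' : tensor U V) :
  (forall y, (forall i, w i y = 0) -> y = 0) ->
  (forall i, rslice (w i) t = rslice (w i) t') -> t = t'.
Proof.
move=> sep h; apply/eqP; rewrite -subr_eq0; apply/eqP.
have [r ->] := rslice_expansion (t - t') sep; rewrite big1 // => p _.
by rewrite linearB /= h subrr (bilin0l (tens_bilin _ _)).
Qed.

Lemma rslice_swap (U V : lmodType K) (f : {scalar U}) (t : tensor U V) :
  rslice f (swap t) = lslice f t.
Proof.
elim/(@tensor_ind K U V): t => [|t t' h h'|u v]; first by rewrite !linear0.
  by rewrite !linearD /= h h'.
by rewrite swapE rsliceE lsliceE.
Qed.

Lemma lslice_separates (U V : lmodType K) (I : Type) (w : I -> {scalar U})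
    (t t' : tensor U V) :
  (forall y, (forall i, w i y = 0) -> y = 0) ->
  (forall i, lslice (w i) t = lslice (w i) t') -> t = t'.
Proof.
move=> sep h; rewrite -(swapK t) -(swapK t'); congr swap.
by apply: (rslice_separates sep) => i; rewrite !rslice_swap.
Qed.

End Separation.

Section LegMaps.
Context {K : fieldType}.
Implicit Types U V W : lmodType K.

Definition tensr U V (v : V) : U -> tensor U V := fun u => u ⊗ v.
Definition tensl U V (u : U) : V -> tensor U V := fun v => u ⊗ v.
Fact tensr_linear U V (v : V) : linear (tensr v : U -> tensor U V).
Proof. by move=> k x y; rewrite /tensr tensDl tensZl. Qed.
Fact tensl_linear U V (u : U) : linear (tensl u : V -> tensor U V).
Proof. by move=> k x y; rewrite /tensl tensDr tensZr. Qed.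
HB.instance Definition _ U V (v : V) :=
  GRing.isLinear.Build K U (tensor U V) *:%R (tensr v) (tensr_linear v).
HB.instance Definition _ U V (u : U) :=
  GRing.isLinear.Build K V (tensor U V) *:%R (tensl u) (tensl_linear u).

Lemma tmap_comp U V U' V' U'' V'' (f : {linear U' -> U''}) (g : {linear V' -> V''})
    (f' : {linear U -> U'}) (g' : {linear V -> V'}) t :
  tmap f g (tmap f' g' t) = tmap (f \o f') (g \o g') t.
Proof.
elim/(@tensor_ind K U V): t => [|t t' h h'|u v]; first by rewrite !linear0.
  by rewrite !linearD /= h h'.
by rewrite !tmapE.
Qed.

Lemma eq_tmap U V U' V' (f f' : {linear U -> U'}) (g g' : {linear V -> V'}) :
  f =1 f' -> g =1 g' -> tmap f g =1 tmap f' g'.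
Proof.
by move=> ff' gg'; apply: linear_tensor_eq => u v /=; rewrite !tmapE ff' gg'.
Qed.

Lemma swap_tmap U V U' V' (f : {linear U -> U'}) (g : {linear V -> V'}) t :
  swap (tmap f g t) = tmap g f (swap t).
Proof.
elim/(@tensor_ind K U V): t => [|t t' h h'|u v]; first by rewrite !linear0.
  by rewrite !linearD /= h h'.
by rewrite tmapE !swapE tmapE.
Qed.

Lemma rslice_tmap U V U' V' (f : {linear U -> U'}) (g : {linear V -> V'})
    (w : {scalar V'}) t :
  rslice w (tmap f g t) = f (rslice (w \o g) t).
Proof.
elim/(@tensor_ind K U V): t => [|t t' h h'|u v]; first by rewrite !linear0.
  by rewrite !linearD /= h h'.
by rewrite tmapE !rsliceE linearZ.
Qed.

Lemma lslice_tmap U V U' V' (f : {linear U -> U'}) (g : {linear V -> V'})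
    (w : {scalar U'}) t :
  lslice w (tmap f g t) = g (lslice (w \o f) t).
Proof.
elim/(@tensor_ind K U V): t => [|t t' h h'|u v]; first by rewrite !linear0.
  by rewrite !linearD /= h h'.
by rewrite tmapE !lsliceE linearZ.
Qed.

Lemma lslice_swap U V (f : {scalar V}) (t : tensor U V) :
  lslice f (swap t) = rslice f t.
Proof. by rewrite -rslice_swap swapK. Qed.

End LegMaps.

(** * Faithful functionals and convolution operators *)

Section Faithfulness.
Context {K : fieldType} {A : nuAlgType K} (phi : {scalar A}).

(** Holds by conversion; it puts faithfulness into the form of a separating family, as the slice
    lemmas expect it. *)
Lemma left_faithful_separates : left_faithful phi ->
  forall a, (forall b, (phi \o nu_rmul b : {scalar A}) a = 0) -> a = 0.
Proof. by []. Qed.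

Lemma right_faithful_separates : right_faithful phi ->
  forall a, (forall c, (phi \o nu_lmul c : {scalar A}) a = 0) -> a = 0.
Proof. by []. Qed.

Lemma tmap_rmul_injl (U : lmodType K) (t t' : tensor A U) : left_faithful phi ->
  (forall c, tmap (nu_rmul c) idfun t = tmap (nu_rmul c) idfun t') -> t = t'.
Proof.
move=> /left_faithful_separates sep h; apply: (lslice_separates sep) => c.
by have /(congr1 (lslice phi)) := h c; rewrite !lslice_tmap.
Qed.

End Faithfulness.

Section Convolution.
Context {K : fieldType} {A : nuAlgType K}.
Variables (T : {linear tensor A A -> tensor A A}) (f : {scalar A}).

(** In Sweedler notation this is a1 f(a2 q) when T is T1; [lconv] is f(a1 q) a2 when T is T4. *)
Definition rconv (q a : A) : A := rslice f (T (a ⊗ q)).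
Definition lconv (q a : A) : A := lslice f (T (q ⊗ a)).
(* [rconv q a] again, with the argument order that makes it linear in q *)
Definition rconvr (a q : A) : A := rslice f (T (a ⊗ q)).

Fact rconv_linear q : linear (rconv q).
Proof. by move=> k x y; rewrite /rconv tensDl tensZl !linearP. Qed.
Fact lconv_linear q : linear (lconv q).
Proof. by move=> k x y; rewrite /lconv tensDr tensZr !linearP. Qed.
Fact rconvr_linear a : linear (rconvr a).
Proof. by move=> k x y; rewrite /rconvr tensDr tensZr !linearP. Qed.
HB.instance Definition _ q :=
  GRing.isLinear.Build K A A *:%R (rconv q) (rconv_linear q).
HB.instance Definition _ q :=
  GRing.isLinear.Build K A A *:%R (lconv q) (lconv_linear q).
HB.instance Definition _ a :=
  GRing.isLinear.Build K A A *:%R (rconvr a) (rconvr_linear a).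

End Convolution.

(** * Faithful integrals for a pair of canonical maps *)

Section IntegralPair.
Context {K : fieldType} {A : nuAlgType K}.

(* [D a] is left multiplication by Delta(a) on A ⊗ A. The last two fields are
   coassociativity with phi, resp. psi, applied to one of the three legs. *)
Record integral_pair (D : A -> {linear tensor A A -> tensor A A})
    (T1 T4 : {linear tensor A A -> tensor A A}) (phi psi : {scalar A}) : Prop :=
  IntegralPair {
  ip_nondeg : nondegenerate_algebra A ;
  ip_phi0 : exists a, phi a != 0 ;
  ip_psi0 : exists a, psi a != 0 ;
  ip_phi : faithful_functional phi ;
  ip_psi : faithful_functional psi ;
  ip_D1 : forall a x y, D a (x ⊗ y) = tmap (nu_rmul x) idfun (T1 (a ⊗ y)) ;
  ip_D4 : forall a x y, D a (x ⊗ y) = tmap idfun (nu_rmul y) (T4 (x ⊗ a)) ;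
  ip_DT1 : forall a a' b, D a (T1 (a' ⊗ b)) = T1 ((a · a') ⊗ b) ;
  ip_DT4 : forall a c a', D a (T4 (c ⊗ a')) = T4 (c ⊗ (a · a')) ;
  ip_T1r : forall a b b', T1 (a ⊗ (b · b')) = tmap idfun (nu_rmul b') (T1 (a ⊗ b)) ;
  ip_T4r : forall c c' a, T4 ((c · c') ⊗ a) = tmap (nu_rmul c') idfun (T4 (c ⊗ a)) ;
  ip_phiT4 : forall c a, rslice phi (T4 (c ⊗ a)) = phi a *: c ;
  ip_psiT1 : forall a b, lslice psi (T1 (a ⊗ b)) = psi a *: b ;
  ip_T4rconv : forall c a q,
    T4 (c ⊗ rconv T1 phi q a) = tmap idfun (rconv T1 phi q) (T4 (c ⊗ a)) ;
  ip_T1lconv : forall a b q,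
    T1 (lconv T4 psi q a ⊗ b) = tmap (lconv T4 psi q) idfun (T1 (a ⊗ b))
}.

Definition flip (T : {linear tensor A A -> tensor A A}) :
  {linear tensor A A -> tensor A A} := swap \o T \o swap.

Lemma flipE T t : flip T t = swap (T (swap t)). Proof. by []. Qed.

Lemma rconv_flip T f q : rconv (flip T) f q =1 lconv T f q.
Proof. by move=> a; rewrite /rconv /lconv flipE swapE rslice_swap. Qed.

Lemma lconv_flip T f q : lconv (flip T) f q =1 rconv T f q.
Proof. by move=> a; rewrite /rconv /lconv flipE swapE lslice_swap. Qed.

(** Passing to the co-opposite coproduct exchanges T1 with T4 and phi with psi, so every result on
    T1 yields one on T4. *)
Lemma integral_pair_flip D T1 T4 phi psi : integral_pair D T1 T4 phi psi ->
  integral_pair (fun a => flip (D a)) (flip T4) (flip T1) psi phi.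
Proof.
case=> nd phi0 psi0 fphi fpsi D1 D4 DT1 DT4 T1r T4r phiT4 psiT1 T4rc T1lc.
split=> // [a x y|a x y|a a' b|a a' b|a b b'|a b b'|c a|c a|c a q|c a q].
- by rewrite !flipE !swapE D4 swap_tmap.
- by rewrite !flipE !swapE D1 swap_tmap.
- by rewrite !flipE !swapE swapK DT4.
- by rewrite !flipE !swapE swapK DT1.
- by rewrite !flipE !swapE T4r swap_tmap.
- by rewrite !flipE !swapE T1r swap_tmap.
- by rewrite !flipE !swapE rslice_swap psiT1.
- by rewrite !flipE !swapE lslice_swap phiT4.
- rewrite rconv_flip !flipE !swapE T1lc swap_tmap; apply: eq_tmap => // x.
  by rewrite /= rconv_flip.
- rewrite lconv_flip !flipE !swapE T4rc swap_tmap; apply: eq_tmap => // x.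
  by rewrite /= lconv_flip.
Qed.

End IntegralPair.

Lemma linear_inverse (K : fieldType) (U V : lmodType K) (f : {linear U -> V}) :
  injective f -> (forall y, exists x, f x = y) ->
  exists g : {linear V -> U}, cancel f g /\ cancel g f.
Proof.
move=> inj surj; pose g y := projT1 (cid (surj y)).
have gK : cancel g f by move=> y; rewrite /g; case: cid.
have g_linear : linear g by move=> k x y; apply: inj; rewrite linearP !gK.
pose g' : {linear V -> U} := HB.pack g (GRing.isLinear.Build K V U *:%R g g_linear).
exists g'.
by split=> [x|] //; apply: inj; exact: gK.
Qed.

Lemma linear_surj_tens (K : fieldType) (W U V : lmodType K)
    (f : {linear W -> tensor U V}) :
  (forall u v, exists x, f x = u ⊗ v) -> forall y, exists x, f x = y.
Proof.
move=> h y; elim/(@tensor_ind K U V): y => [|_ _ [x <-] [y <-]|u v] //.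
  by exists 0; rewrite linear0.
by exists (x + y); rewrite linearD.
Qed.

(** * Bijectivity of T1 and a one-sided counit *)

Section IntegralPairTheory.
Context {K : fieldType} {A : nuAlgType K}.
Context {D : A -> {linear tensor A A -> tensor A A}}.
Context {T1 T4 : {linear tensor A A -> tensor A A}} {phi psi : {scalar A}}.
Hypothesis H : integral_pair D T1 T4 phi psi.
Local Notation R := (rconv T1 phi).

Let phil := (ip_phi H).1.

Lemma ip_DT1_map a x : D a (T1 x) = T1 (tmap (nu_lmul a) idfun x).
Proof.
elim/(@tensor_ind K A A): x => [|x y h h'|u v]; first by rewrite !linear0.
  by rewrite !linearD /= h h'.
by rewrite tmapE (ip_DT1 H).
Qed.

Lemma ip_lslice_T1 x : lslice psi (T1 x) = lslice psi x.
Proof.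
elim/(@tensor_ind K A A): x => [|x y h h'|u v]; first by rewrite !linear0.
  by rewrite !linearD /= h h'.
by rewrite (ip_psiT1 H) lsliceE.
Qed.

(** Multiplying T1 z by Delta(c) gives T1 ((c ⊗ 1) z), and by invariance its psi-slice is the slice
    of z by psi(c ·). These slices determine z, as psi is right faithful. *)
Lemma ip_T1_inj : injective T1.
Proof.
move=> x y xy; apply: (lslice_separates (right_faithful_separates (ip_psi H).2)).
move=> c; have E z : lslice (psi \o nu_lmul c) z = lslice psi (D c (T1 z)).
  by rewrite ip_DT1_map ip_lslice_T1 lslice_tmap.
by rewrite !E xy.
Qed.

(* In Sweedler notation [fill p (q1 b ⊗ q2)] is p1 ⊗ q1 b phi(p2 q2), and the
   claim of [ip_T1_fill] reads p1 ⊗ p2 q1 b phi(p3 q2) = p1 phi(p2 q) ⊗ b. *)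
Definition fill p : tensor A A -> tensor A A :=
  swap \o tmap idfun (rconvr T1 phi p).
HB.instance Definition _ p := GRing.Linear.on (fill p).

Lemma fillE p u v : fill p (u ⊗ v) = R v p ⊗ u.
Proof. by rewrite /fill /= tmapE swapE. Qed.

Lemma ip_rslice_D p u v : rslice phi (D p (u ⊗ v)) = R v p · u.
Proof. by rewrite (ip_D1 H) rslice_tmap. Qed.

Lemma mult_fill p t : nu_mult (fill p t) = rslice phi (D p t).
Proof.
elim/(@tensor_ind K A A): t => [|x y h h'|u v]; first by rewrite !linear0.
  by rewrite !linearD /= h h'.
by rewrite fillE nu_multE ip_rslice_D.
Qed.

(** The left side is p1 q1 b phi(p2 q2), and left invariance applies to the product pq. *)
Lemma mult_fill_T4 p b q : nu_mult (fill p (T4 (b ⊗ q))) = phi (p · q) *: b.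
Proof. by rewrite mult_fill (ip_DT4 H) (ip_phiT4 H). Qed.

Lemma ip_T1_fill p b q : T1 (fill p (T4 (b ⊗ q))) = R q p ⊗ b.
Proof.
(* Multiplying the first leg by c on the right brings in T4 (c ⊗ p) = p1 c ⊗ p2, to which
   coassociativity applies. *)
apply: (tmap_rmul_injl phil) => c.
(* The right side is p1 c ⊗ m([fill] p2 t), with m the multiplication of A. *)
have E t : tmap (nu_rmul c) idfun (T1 (fill p t)) =
    tensor_lift (fun r s => r ⊗ nu_mult (fill s t)) (T4 (c ⊗ p)).
  elim/(@tensor_ind K A A): t => [|x y h h'|u v].
  - rewrite !linear0 /tensor_lift big1 // => r _.
    by rewrite !linear0 (bilin0r (tens_bilin _ _)).
  - rewrite !linearD /= h h' -tensor_lift_addf; apply: eq_tensor_lift => r s.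
    by rewrite !linearD tensDr.
  - rewrite fillE -(ip_D1 H) (ip_D4 H) (ip_T4rconv H) tmap_comp.
    by apply: eq_tensor_lift => r s; rewrite fillE nu_multE.
rewrite {}E tmapE /= -[nu_rmul c _]/(R q p · c) -ip_rslice_D (ip_D4 H) rslice_tmap /=.
(* Both sides become p1 c phi(p2 q) ⊗ b. *)
transitivity (tensor_lift (fun r s => r ⊗ (phi (s · q) *: b)) (T4 (c ⊗ p))).
  by apply: eq_tensor_lift => r s; rewrite mult_fill_T4.
rewrite /tensor_lift /rslice /tensor_lift.
rewrite (big_morph _ (fun x y => tensDl x y b) (bilin0l (tens_bilin A A) b)).
by apply: eq_bigr => r _; rewrite tensZl tensZr.
Qed.

Lemma ip_rconv_unit a : exists q, R q a = a.
Proof.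
have [b pb] := ip_phi0 H.
(* The slice of T1 (a ⊗ b) by phi(· v) is a1 phi(a2 b v), so each term of the expansion is in the
   range of T1 by [ip_T1_fill]. *)
have [r hr] := rslice_expansion (T1 (a ⊗ b)) (left_faithful_separates phil).
pose t := \sum_(p <- r) T4 (p.2 ⊗ (b · p.1)).
have E : a ⊗ b = fill a t.
  apply: ip_T1_inj; rewrite {1}hr /t (linear_sum (fill a)) (linear_sum T1).
  apply: eq_bigr => p _ /=.
  by rewrite ip_T1_fill /rconv (ip_T1r H) rslice_tmap.
(* Slicing the second leg of a ⊗ b = [fill a t] by phi gives phi(b) a = R q a with q =
   [lslice phi t]; it remains to divide by phi(b). *)
exists ((phi b)^-1 *: lslice phi t).
have /(congr1 (rslice phi)) := E.
rewrite rsliceE /fill /= rslice_swap lslice_tmap /= => E'.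
rewrite -[LHS]/(rconvr T1 phi a ((phi b)^-1 *: lslice phi t)) linearZ /=.
by rewrite -E' scalerA mulVf // scale1r.
Qed.

Lemma ip_T1_surj y : exists x, T1 x = y.
Proof.
apply: linear_surj_tens => a b; have [q qa] := ip_rconv_unit a.
by exists (fill a (T4 (b ⊗ q))); rewrite ip_T1_fill qa.
Qed.

(** The formula eps(p1 phi(p2 q)) = phi(pq) is well defined because phi(pq) b is the product of the
    legs of T1^-1 (p1 phi(p2 q) ⊗ b). Accordingly eps(a) is defined as phi(m(T1^-1 (a ⊗ e))) with
    phi(e) = 1. *)
Lemma ip_left_counit : exists eps : {scalar A},
  (forall x, lslice eps (T1 x) = nu_mult x) /\
  (forall p q, eps (R q p) = phi (p · q)).
Proof.
have [T1' [T1K T1'K]] := linear_inverse ip_T1_inj ip_T1_surj.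
have [b pb] := ip_phi0 H.
pose e := (phi b)^-1 *: b; have pe : phi e = 1.
  by rewrite /e linearZ /= mulVf.
pose eps : {scalar A} := phi \o nu_mult \o T1' \o tensr e.
have epsR p q : eps (R q p) = phi (p · q).
  rewrite /eps /= /tensr -ip_T1_fill T1K mult_fill_T4 linearZ /=.
  by rewrite -[LHS]/(phi (p · q) * phi e) pe mulr1.
exists eps; split=> // x; rewrite -[in RHS](T1K x); move: (T1 x) => {x} t.
elim/(@tensor_ind K A A): t => [|x y h h'|u v]; first by rewrite !linear0.
  by rewrite !linearD /= h h'.
have [q <-] := ip_rconv_unit u.
by rewrite lsliceE epsR -ip_T1_fill T1K mult_fill_T4.
Qed.

End IntegralPairTheory.

(** * The two-sided counit *)

Section Counit.
Context {K : fieldType} {A : nuAlgType K}.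
Context {D : A -> {linear tensor A A -> tensor A A}}.
Context {T1 T4 : {linear tensor A A -> tensor A A}} {phi psi : {scalar A}}.
Hypothesis H : integral_pair D T1 T4 phi psi.

(** The [swap] reflects that Delta(a)(c ⊗ 1) is sliced to ac, while T4 takes c ⊗ a. *)
Record counit (T1 T4 : {linear tensor A A -> tensor A A}) (eps : {scalar A}) :
    Prop := Counit {
  counit_T1 : forall x, lslice eps (T1 x) = nu_mult x ;
  counit_T4 : forall x, rslice eps (T4 x) = nu_mult (swap x) ;
  counitM : forall a b, eps (a · b) = eps a * eps b
}.

Lemma counit_flip (eps : {scalar A}) :
  counit T1 T4 eps -> counit (flip T4) (flip T1) eps.
Proof.
case=> e1 e4 eM; split=> // x; rewrite flipE.
  by rewrite lslice_swap e4 swapK.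
by rewrite rslice_swap e1.
Qed.

Lemma ip_T4_inj : injective T4.
Proof.
move=> x y xy; have inj := ip_T1_inj (integral_pair_flip H).
have /inj : flip T4 (swap x) = flip T4 (swap y) by rewrite !flipE !swapK xy.
by move/(congr1 swap); rewrite !swapK.
Qed.

Lemma ip_T4_surj y : exists x, T4 x = y.
Proof.
have [x hx] := ip_T1_surj (integral_pair_flip H) (swap y).
by exists (swap x); rewrite -[LHS]swapK -flipE hx swapK.
Qed.

Lemma ip_neq0 : exists a : A, a <> 0.
Proof. by have [a pa] := ip_phi0 H; exists a => a0; rewrite a0 linear0 eqxx in pa. Qed.

Lemma scaler_injl (b : A) (k l : K) : b <> 0 -> k *: b = l *: b -> k = l.
Proof.
move=> /eqP b0 /eqP; rewrite -subr_eq0 -scalerBl scaler_eq0 (negPf b0) orbF.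
by rewrite subr_eq0 => /eqP.
Qed.

(** The one-sided counits [eps] of the pair and [eps'] of the flipped pair take the same value
    phi(pq) at p1 phi(p2 q), and every element has this form. *)
Lemma ip_counit : exists eps : {scalar A},
  counit T1 T4 eps /\ forall p q, eps (rconv T1 phi q p) = phi (p · q).
Proof.
have [eps [eps1 epsR]] := ip_left_counit H.
have [eps' [eps'1 _]] := ip_left_counit (integral_pair_flip H).
have eps'4 x : rslice eps' (T4 x) = nu_mult (swap x).
  by rewrite -eps'1 flipE lslice_swap swapK.
have [b b0] := ip_neq0.
(* Slices of T4 x suffice, since b ⊗ s lies in the range of T4 and b is nonzero. On T4 (c ⊗ p),
   coassociativity turns both slices into p1 phi(p2 q) c. *)
have E q : eps' \o rconv T1 phi q =1 phi \o nu_rmul q.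
  move=> s; have [x hx] := ip_T4_surj (b ⊗ s).
  have Ex : rslice (eps' \o rconv T1 phi q) (T4 x) = rslice (phi \o nu_rmul q) (T4 x).
    elim/(@tensor_ind K A A): x {hx} => [|x y h h'|c p]; first by rewrite !linear0.
      by rewrite !linearD /= h h'.
    transitivity (rslice eps' (T4 (c ⊗ rconv T1 phi q p))).
      by rewrite (ip_T4rconv H) rslice_tmap.
    rewrite eps'4 swapE nu_multE -(ip_rslice_D H) (ip_D4 H).
    by rewrite rslice_tmap.
  by move: Ex; rewrite hx !rsliceE => /(scaler_injl b0).
have eps_eq a : eps' a = eps a.
  by have [q <-] := ip_rconv_unit H a; rewrite epsR; exact: E.
exists eps; split=> //; split=> // [x|a c].
  rewrite -eps'4; elim/(@tensor_ind K A A): (T4 x) => [|y z h h'|u v].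
  - by rewrite !linear0.
  - by rewrite !linearD /= h h'.
  - by rewrite !rsliceE eps_eq.
have epsD u t : lslice eps (D u t) = u · lslice eps t.
  have [x <-] := ip_T1_surj H t; rewrite (ip_DT1_map H) !eps1.
  elim/(@tensor_ind K A A): x => [|x y h h'|u' v'].
  - by rewrite !linear0 nu_mul0r.
  - by rewrite !linearD /= h h' nu_mulDr.
  - by rewrite tmapE !nu_multE /nu_lmul mulgA.
(* For t = T1 (u ⊗ v) the left side is the [eps]-slice of Delta(u)(p ⊗ v), which is u eps(p) v.
   Taking t = a ⊗ b then gives multiplicativity. *)
have E1 p (t : tensor A A) : lslice (eps \o nu_rmul p) t = eps p *: lslice eps t.
  have [x <-] := ip_T1_surj H t.
  elim/(@tensor_ind K A A): x => [|x y h h'|u v]; first by rewrite !linear0 ?scaler0.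
    by rewrite !linearD /= h h' ?scalerDr.
  transitivity (lslice eps (D u (p ⊗ v))); first by rewrite (ip_D1 H) lslice_tmap.
  by rewrite epsD eps1 nu_multE lsliceE nu_mulZr.
have := E1 c (a ⊗ b); rewrite !lsliceE scalerA mulrC.
by move=> /(scaler_injl b0).
Qed.

End Counit.

(** * The antipode and the construction of T2 *)

Section Antipode.
Context {K : fieldType} {A : nuAlgType K}.

(** If eps vanished, all products in A would vanish by the counit property, against
    non-degeneracy. *)
Lemma counit_eq1 D T1 T4 (phi psi : {scalar A}) eps :
  integral_pair D T1 T4 phi psi -> counit T1 T4 eps -> exists b : A, eps b = 1.
Proof.
move=> H [eps1 _ _]; have [a a0] := ip_neq0 H.
have [b pb] : exists b, eps b != 0.
  apply: contrapT => h; apply: a0; apply: (ip_nondeg H).1 => c.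
  rewrite -nu_multE -eps1; elim/(@tensor_ind K A A): (T1 _) => [|x y h1 h2|u v].
  - by rewrite linear0.
  - by rewrite linearD /= h1 h2 addr0.
  - rewrite lsliceE; have [->|un] := eqVneq (eps u) 0; first by rewrite scale0r.
    by case: h; exists u.
by exists ((eps b)^-1 *: b); rewrite linearZ /= mulVf.
Qed.

(* With S the antipode, T1^-1(a ⊗ b) = a1 ⊗ S(a2)b and
   T4^-1(c ⊗ a) = S^-1(a1)c ⊗ a2, so that for T1 x = T4 y = c ⊗ a the two slices
   below are S(c)a and S^-1(a)c. *)
Lemma ip_antipode D T1 T4 (phi psi : {scalar A}) eps :
  integral_pair D T1 T4 phi psi -> counit T1 T4 eps ->
  exists S : {linear A -> A},
    (forall x y, T1 x = T4 y -> S (rslice eps y) = lslice eps x) /\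
    (forall x c b, T1 x = c ⊗ b -> S c · b = lslice eps x).
Proof.
move=> H heps; have [e ee] := counit_eq1 H heps; have [eps1 eps4 epsM] := heps.
have [T1' [T1K T1'K]] := linear_inverse (ip_T1_inj H) (ip_T1_surj H).
(* This s is (eps ⊗ id) T1^-1, so that s(c ⊗ b) stands for S(c) b. *)
have [s sT1] : exists s : {linear tensor A A -> A}, forall x, s (T1 x) = lslice eps x.
  by exists (lslice eps \o T1') => x /=; rewrite T1K.
(* This is S(a1 u) a2 v = eps(a) S(u) v. *)
have sD a t : s (D a t) = eps a *: s t.
  rewrite -(T1'K t) (ip_DT1_map H) !sT1 lslice_tmap; move: (T1' t) => {}t /=.
  elim/(@tensor_ind K A A): t => [|x y h h'|u v]; first by rewrite !linear0 ?scaler0.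
    by rewrite !linearD /= h h' ?scalerDr.
  by rewrite !lsliceE scalerA /= epsM.
have sr x t : s (tmap idfun (nu_rmul x) t) = s t · x.
  rewrite -(T1'K t) sT1; move: (T1' t) => {}t.
  elim/(@tensor_ind K A A): t => [|y z h h'|u v].
  - by rewrite !linear0 nu_mul0l.
  - by rewrite !linearD /= h h' nu_mulDl.
  - by rewrite -(ip_T1r H) sT1 !lsliceE nu_mulZl.
have sT4 y x : s (T4 y) · x = s (rslice eps y ⊗ x).
  elim/(@tensor_ind K A A): y => [|y z h h'|u v].
  - by rewrite !linear0 nu_mul0l (bilin0l (tens_bilin _ _)) linear0.
  - by rewrite !linearD /= nu_mulDl h h' tensDl linearD.
  - by rewrite -sr -(ip_D4 H) sD rsliceE tensZl linearZ.
(* Since eps(e) = 1, [sT4] gives s(T4 (c ⊗ e)) b = s(c ⊗ b): the left multiplier S(c) is given by an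
   element of A. *)
pose S : {linear A -> A} := s \o T4 \o tensr e.
have Ss c b : S c · b = s (c ⊗ b) by rewrite sT4 rsliceE ee scale1r.
exists S; split=> [x y xy|x c b xcb]; last by rewrite Ss -xcb sT1.
by apply: nondegenerate_injl (ip_nondeg H) _ => c; rewrite Ss -sT4 -xy sT1.
Qed.

(** Both sides of the identity are c a1 x ⊗ a2, which expresses T2 (c ⊗ a) = (c ⊗ 1) Delta(a)
    without multipliers. *)
Lemma ip_T2 D T1 T4 (phi psi : {scalar A}) : integral_pair D T1 T4 phi psi ->
  exists2 T2 : {linear tensor A A -> tensor A A}, bijective T2 &
    forall c a x, tmap (nu_lmul c) idfun (T4 (x ⊗ a)) =
                  tmap (nu_rmul x) idfun (T2 (c ⊗ a)).
Proof.
move=> H; have [eps [heps epsR]] := ip_counit H.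
have [e ee] := counit_eq1 H heps.
have Hf := integral_pair_flip H.
have [S [S14 SE]] := ip_antipode H heps.
have [S' [S'14 _]] := ip_antipode Hf (counit_flip heps).
have S'E x y : T1 x = T4 y -> S' (lslice eps x) = rslice eps y.
  move=> xy; rewrite -rslice_swap (S'14 (swap y)) ?lslice_swap //.
  by rewrite !flipE !swapK xy.
(* When T1 x = T4 y, S sends the eps-slice of y to that of x, and S' sends it back. Choosing y = u ⊗
   e makes the slice of y equal to u. *)
have SK : cancel S S'.
  move=> u; have [x hx] := ip_T1_surj H (T4 (u ⊗ e)).
  by have := S'E _ _ hx; rewrite -(S14 _ _ hx) rsliceE ee scale1r.
have S'K : cancel S' S.
  move=> u; have [y hy] := ip_T4_surj H (T1 (e ⊗ u)).
  by have := S14 _ _ (esym hy); rewrite -(S'E _ _ (esym hy)) lsliceE ee scale1r.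
have [T4' [T4K T4'K]] := linear_inverse (ip_T4_inj H) (ip_T4_surj H).
have [T1' [T1K T1'K]] := linear_inverse (ip_T1_inj H) (ip_T1_surj H).
have tmapK (f g : {linear A -> A}) : cancel f g ->
    cancel (tmap f idfun) (tmap g (@idfun A)).
  move=> fK t; rewrite tmap_comp; elim/(@tensor_ind K A A): t => [|t t' h h'|u v].
  - by rewrite linear0.
  - by rewrite linearD /= h h'.
  - by rewrite tmapE /= fK.
(* T4^-1 sends S^-1(c) ⊗ a to S^-1(a1) S^-1(c) ⊗ a2, and S reverses the product to give c a1 ⊗
   a2. *)
exists (tmap S idfun \o T4' \o tmap S' idfun).
  exists (tmap S idfun \o T4 \o tmap S' idfun) => t /=.
    by rewrite (tmapK _ _ SK) T4'K (tmapK _ _ S'K).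
  by rewrite (tmapK _ _ SK) T4K (tmapK _ _ S'K).
move=> c a x /=; rewrite tmapE /=.
rewrite -{1}(S'K c); set c' := S' c; set y := T4' _.
have T4y : T4 y = c' ⊗ a by rewrite T4'K.
(* After slicing by phi(· d) and cancelling x, the claim is that S(c') times a1 phi(a2 d) equals S
   of the slice of y. *)
apply: (rslice_separates (left_faithful_separates (ip_phi H).1)) => d.
rewrite !rslice_tmap.
transitivity (S c' · (rconv T1 phi d a · x)).
  by congr (_ · _); rewrite -(ip_rslice_D H) (ip_D4 H) rslice_tmap.
rewrite mulgA; congr (_ · _).
have T4R z : T4 (tmap idfun (rconv T1 phi d) z) = tmap idfun (rconv T1 phi d) (T4 z).
  elim/(@tensor_ind K A A): z => [|z z' h h'|u v]; first by rewrite !linear0.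
    by rewrite !linearD /= h h'.
  by rewrite tmapE (ip_T4rconv H).
(* Here T1 z = c' ⊗ a1 phi(a2 d), so both descriptions of S apply to z; eps composed with R d is
   phi(· d). *)
have [z hz] := ip_T1_surj H (T4 (tmap idfun (rconv T1 phi d) y)).
have := S14 _ _ hz; rewrite -(SE z c' (rconv T1 phi d a)); last first.
  by rewrite hz T4R T4y tmapE.
move=> <-; congr (S _); rewrite rslice_tmap /=.
by apply: eq_tensor_lift => u v; rewrite /= epsR.
Qed.

End Antipode.

(** * The forms of coassociativity *)

Section Coassociativity.
Context {K : fieldType}.

Lemma tmap_assoc_inv (U V W W' : lmodType K) (g : {linear W -> W'})
    (t : tensor U (tensor V W)) :
  tmap idfun g (assoc_inv t) = assoc_inv (tmap idfun (tmap idfun g) t).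
Proof.
elim/(@tensor_ind3r K U V W): t => [|t t' h h'|u v w]; first by rewrite !linear0.
  by rewrite !linearD /= h h'.
by rewrite assoc_inv_tens !tmapE /= ?tmapE assoc_inv_tens.
Qed.

Lemma tmapl_assoc_inv (U V W U' : lmodType K) (f : {linear U -> U'})
    (t : tensor U (tensor V W)) :
  tmap (tmap f idfun) idfun (assoc_inv t) = assoc_inv (tmap f idfun t).
Proof.
elim/(@tensor_ind3r K U V W): t => [|t t' h h'|u v w]; first by rewrite !linear0.
  by rewrite !linearD /= h h'.
by rewrite assoc_inv_tens !tmapE /= ?tmapE assoc_inv_tens ?tmapE.
Qed.

Lemma rslice_assoc_inv (U V W : lmodType K) (f : {scalar W})
    (t : tensor U (tensor V W)) :
  rslice f (assoc_inv t) = tmap idfun (rslice f) t.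
Proof.
elim/(@tensor_ind3r K U V W): t => [|t t' h h'|u v w]; first by rewrite !linear0.
  by rewrite !linearD /= h h'.
by rewrite assoc_inv_tens tmapE /= !rsliceE tensZr.
Qed.

Lemma lslice_assoc (U V W : lmodType K) (f : {scalar U})
    (t : tensor (tensor U V) W) :
  lslice f (assoc t) = tmap (lslice f) idfun t.
Proof.
elim/(@tensor_ind3 K U V W): t => [|t t' h h'|u v w]; first by rewrite !linear0.
  by rewrite !linearD /= h h'.
by rewrite assoc_tens tmapE /= !lsliceE tensZl.
Qed.

Context {A : nuAlgType K}.
Implicit Types X Y T : {linear tensor A A -> tensor A A}.

(* All four forms of coassociativity have this shape, with X = T2 or T4 and
   Y = T1 or T3. *)
Definition coassoc_pair X Y := forall a b c : A,
  tmap (X \o tensl c) idfun (Y (a ⊗ b)) =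
  assoc_inv (tmap idfun (Y \o tensr b) (X (c ⊗ a))).

Lemma coassoc_pair_ext X X' Y Y' :
  X =1 X' -> Y =1 Y' -> coassoc_pair X Y -> coassoc_pair X' Y'.
Proof.
move=> XX' YY' co a b c; rewrite -XX' -YY'.
transitivity (tmap (X \o tensl c) idfun (Y (a ⊗ b))).
  by apply: eq_tmap => // p /=; rewrite XX'.
by rewrite co; congr assoc_inv; apply: eq_tmap => // p /=; rewrite YY'.
Qed.

Variables (phi : {scalar A}) (lam rho : A -> {linear A -> A}).
Hypothesis sep : forall y, (forall b, (phi \o rho b : {scalar A}) y = 0) -> y = 0.

(** Used to pass between T1 and T3: [lam] and [rho] are the left and right multiplications, in
    either order, and the hypothesis is associativity of the product of 1 ⊗ b, Delta(a) and 1 ⊗ b'.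
    Applying [rho b] to the last leg loses nothing, by [sep]. *)
Lemma coassoc_pair_right X Y Y' :
  (forall a b b', tmap idfun (lam b') (Y (a ⊗ b)) =
                  tmap idfun (rho b) (Y' (a ⊗ b'))) ->
  coassoc_pair X Y -> coassoc_pair X Y'.
Proof.
move=> YY' co a b' c; apply: (rslice_separates sep) => b.
suff /(congr1 (rslice phi)) :
    tmap idfun (rho b) (tmap (X \o tensl c) idfun (Y' (a ⊗ b'))) =
    tmap idfun (rho b) (assoc_inv (tmap idfun (Y' \o tensr b') (X (c ⊗ a)))).
  by rewrite !rslice_tmap.
transitivity (tmap (X \o tensl c) idfun (tmap idfun (rho b) (Y' (a ⊗ b')))).
  by rewrite !tmap_comp; exact: eq_tmap.
rewrite -YY'.
transitivity (tmap idfun (lam b') (tmap (X \o tensl c) idfun (Y (a ⊗ b)))).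
  by rewrite !tmap_comp; exact: eq_tmap.
rewrite co !tmap_assoc_inv !tmap_comp; congr assoc_inv.
by apply: eq_tmap => // s /=; exact: YY'.
Qed.

(** The analogue on the first leg, passing between T2 and T4; [assoc] isolates that leg for
    slicing. *)
Lemma coassoc_pair_left X X' Y :
  (forall a c c', tmap (lam c') idfun (X (c ⊗ a)) =
                  tmap (rho c) idfun (X' (c' ⊗ a))) ->
  coassoc_pair X Y -> coassoc_pair X' Y.
Proof.
move=> XX' co a b c'; apply: (can_inj (@assocK K A A A)).
apply: (lslice_separates sep) => c.
suff /(congr1 (fun t => lslice phi (assoc t))) :
    tmap (tmap (rho c) idfun) idfun (tmap (X' \o tensl c') idfun (Y (a ⊗ b))) =
    tmap (tmap (rho c) idfun) idfun
      (assoc_inv (tmap idfun (Y \o tensr b) (X' (c' ⊗ a)))).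
  have E (t : tensor (tensor A A) A) :
      lslice phi (assoc (tmap (tmap (rho c) idfun) idfun t)) =
      lslice (phi \o rho c) (assoc t).
    by rewrite -(assocK t) tmapl_assoc_inv !assoc_invK lslice_tmap.
  by rewrite /= !E.
rewrite tmapl_assoc_inv.
transitivity (tmap (tmap (lam c') idfun \o X \o tensl c) idfun (Y (a ⊗ b))).
  by rewrite tmap_comp; apply: eq_tmap => // p /=; exact/esym/XX'.
transitivity (tmap (tmap (lam c') idfun) idfun
    (tmap (X \o tensl c) idfun (Y (a ⊗ b)))).
  by rewrite tmap_comp; exact: eq_tmap.
rewrite co tmapl_assoc_inv; congr assoc_inv.
transitivity (tmap idfun (Y \o tensr b) (tmap (lam c') idfun (X (c ⊗ a)))).
  by rewrite !tmap_comp; exact: eq_tmap.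
by rewrite XX' !tmap_comp; exact: eq_tmap.
Qed.

End Coassociativity.

(** * Non-degenerate tensor products and construction of integral pairs *)

Section NondegenerateTensor.
Context {K : fieldType}.

Lemma tensor_mul_tens_r (A B : nuAlgType K) (t : tensor A B) x y :
  t · (x ⊗ y) = tmap (nu_rmul x) (nu_rmul y) t.
Proof.
elim/(@tensor_ind K A B): t => [|t t' h h'|u v].
- by rewrite nu_mul0l linear0.
- by rewrite nu_mulDl linearD /= h h'.
- by rewrite tensM tmapE.
Qed.

Lemma tensor_mul_tens_l (A B : nuAlgType K) (t : tensor A B) x y :
  (x ⊗ y) · t = tmap (nu_lmul x) (nu_lmul y) t.
Proof.
elim/(@tensor_ind K A B): t => [|t t' h h'|u v].
- by rewrite nu_mul0r linear0.
- by rewrite nu_mulDr linearD /= h h'.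
- by rewrite tensM tmapE.
Qed.

(** Slicing t (c ⊗ d) = 0 by phi shows that the slice of t by phi(· d) annihilates A, hence
    vanishes; faithfulness of phi then gives t = 0. *)
Lemma nondegenerate_tensor (A B : nuAlgType K) (phi : {scalar B}) :
  nondegenerate_algebra A -> faithful_functional phi ->
  nondegenerate_algebra (tensor A B).
Proof.
move=> [ndl ndr] [fl fr]; split=> t ht.
  apply: (rslice_separates (left_faithful_separates fl)) => d.
  rewrite linear0; apply: ndl => c.
  have /(congr1 (rslice phi)) := ht (c ⊗ d).
  by rewrite tensor_mul_tens_r rslice_tmap linear0.
apply: (rslice_separates (right_faithful_separates fr)) => d.
rewrite linear0; apply: ndr => c.
have /(congr1 (rslice phi)) := ht (c ⊗ d).
by rewrite tensor_mul_tens_l rslice_tmap linear0.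
Qed.

Lemma tens_mul_injl (A B : nuAlgType K) (t t' : tensor A B) :
  nondegenerate_algebra (tensor A B) ->
  (forall x y, t · (x ⊗ y) = t' · (x ⊗ y)) -> t = t'.
Proof.
move=> nd h; apply: nondegenerate_injl nd _.
elim/(@tensor_ind K A B) => [|u v h1 h2|x y //]; first by rewrite !nu_mul0r.
by rewrite !nu_mulDr h1 h2.
Qed.

End NondegenerateTensor.

Section IntegralPairIntro.
Context {K : fieldType} {A : nuAlgType K}.

Lemma integral_pair_intro (D : A -> {linear tensor A A -> tensor A A})
    (T1 T4 : {linear tensor A A -> tensor A A}) (phi psi : {scalar A}) :
  nondegenerate_algebra A ->
  (exists a, phi a != 0) -> (exists a, psi a != 0) ->
  faithful_functional phi -> faithful_functional psi ->
  (forall a t u, D a (t · u) = D a t · u) ->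
  (forall a b t, D (a · b) t = D a (D b t)) ->
  (forall a b x y, T1 (a ⊗ b) · (x ⊗ y) = D a (x ⊗ (b · y))) ->
  (forall c a x y, T4 (c ⊗ a) · (x ⊗ y) = D a ((c · x) ⊗ y)) ->
  (forall c a, rslice phi (T4 (c ⊗ a)) = phi a *: c) ->
  (forall a b, lslice psi (T1 (a ⊗ b)) = psi a *: b) ->
  coassoc_pair T4 T1 ->
  integral_pair D T1 T4 phi psi.
Proof.
move=> nd phi0 psi0 fphi fpsi Dr DM hT1 hT4 phiT4 psiT1 co.
have nd2 := nondegenerate_tensor nd fphi.
have rmull (t : tensor A A) c x y :
    tmap (nu_rmul c) idfun t · (x ⊗ y) = t · ((c · x) ⊗ y).
  rewrite !tensor_mul_tens_r tmap_comp; apply: eq_tmap => // a /=.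
  by rewrite /nu_rmul mulgA.
have rmulr (t : tensor A A) c x y :
    tmap idfun (nu_rmul c) t · (x ⊗ y) = t · (x ⊗ (c · y)).
  rewrite !tensor_mul_tens_r tmap_comp; apply: eq_tmap => // a /=.
  by rewrite /nu_rmul mulgA.
split=> // [a x y|a x y|a a' b|a c a'|a b b'|c c' a|c a q|a b q].
- by apply: tens_mul_injl nd2 _ => u v; rewrite rmull hT1 -Dr tensM.
- by apply: tens_mul_injl nd2 _ => u v; rewrite rmulr hT4 -Dr tensM.
- by apply: tens_mul_injl nd2 _ => u v; rewrite -Dr !hT1 DM.
- by apply: tens_mul_injl nd2 _ => u v; rewrite -Dr !hT4 DM.
- by apply: tens_mul_injl nd2 _ => u v; rewrite rmulr !hT1 mulgA.
- by apply: tens_mul_injl nd2 _ => u v; rewrite rmull !hT4 mulgA.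
(* The last two fields are coassociativity with phi on the third leg and psi on the first. *)
- have /(congr1 (rslice phi)) := co a q c.
  rewrite rslice_tmap rslice_assoc_inv tmap_comp /= => E.
  by rewrite [LHS]E; exact: eq_tmap.
- have /(congr1 (fun t => lslice psi (assoc t))) := co a b q.
  rewrite /= assoc_invK lslice_tmap lslice_assoc tmap_comp /= => E.
  by rewrite -[LHS]E; exact: eq_tmap.
Qed.

(* T2 and T3 written as left multiplications on A ⊗ A *)
Lemma integral_pair_bij D T1 T4 (phi psi : {scalar A}) :
  integral_pair D T1 T4 phi psi ->
  [/\ bijective T1, bijective T4,
   exists2 T2 : {linear tensor A A -> tensor A A}, bijective T2 &
    forall c a x y, T2 (c ⊗ a) · (x ⊗ y) = tmap (nu_lmul c) idfun (D a (x ⊗ y)) &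
   exists2 T3 : {linear tensor A A -> tensor A A}, bijective T3 &
    forall a b x y, T3 (a ⊗ b) · (x ⊗ y) = tmap idfun (nu_lmul b) (D a (x ⊗ y))].
Proof.
move=> H; have Hf := integral_pair_flip H; split.
- have [T' [TK T'K]] := linear_inverse (ip_T1_inj H) (ip_T1_surj H).
  by exists T'.
- have [T' [TK T'K]] := linear_inverse (ip_T4_inj H) (ip_T4_surj H).
  by exists T'.
- have [T2 bT2 hT2] := ip_T2 H; exists T2 => // c a x y.
  rewrite tensor_mul_tens_r (ip_D4 H).
  transitivity (tmap idfun (nu_rmul y) (tmap (nu_lmul c) idfun (T4 (x ⊗ a)))).
    by rewrite hT2 tmap_comp; exact: eq_tmap.
  by rewrite !tmap_comp; exact: eq_tmap.
(* T3 is the T2 of the co-opposite coproduct, with its legs exchanged. *)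
have [T3 [T' TK T'K] hT3] := ip_T2 Hf; exists (flip T3).
  by exists (swap \o T' \o swap) => t; rewrite /= ?flipE swapK ?TK ?T'K swapK.
move=> a b x y; rewrite tensor_mul_tens_r (ip_D1 H) flipE swapE.
have := hT3 b a y; rewrite flipE swapE => /(congr1 swap).
rewrite !swap_tmap swapK => h3.
transitivity (tmap (nu_rmul x) idfun (tmap idfun (nu_lmul b) (T1 (a ⊗ y)))).
  by rewrite h3 tmap_comp; exact: eq_tmap.
by rewrite !tmap_comp; exact: eq_tmap.
Qed.

End IntegralPairIntro.

(** * Multipliers and the opposite algebra *)

Section Multipliers.
Context {K : fieldType}.

HB.instance Definition _ (A : nuAlgType K) (m : multiplier A) :=
  GRing.isLinear.Build K A A *:%R (lmul m) (lmul_linear m).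
HB.instance Definition _ (A : nuAlgType K) (m : multiplier A) :=
  GRing.isLinear.Build K A A *:%R (rmul m) (rmul_linear m).
HB.instance Definition _ (A : nuAlgType K) :=
  GRing.isLinear.Build K A (multiplier A) *:%R (@emb K A) (@emb_linear K A).

Context {A B : nuAlgType K}.

Lemma lmul_inj (m n : multiplier A) :
  nondegenerate_algebra A -> lmul m =1 lmul n -> m = n.
Proof.
move=> nd mn; apply: multiplier_eq => // a; apply: nondegenerate_injl nd _ => b.
by rewrite -!lrmul mn.
Qed.

Lemma rmul_inj (m n : multiplier A) :
  nondegenerate_algebra A -> rmul m =1 rmul n -> m = n.
Proof.
move=> nd mn; apply: multiplier_eq => // a; apply: nondegenerate_injr nd _ => b.
by rewrite !lrmul mn.
Qed.

Lemma mtensM (m m' : multiplier A) (n n' : multiplier B) :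
  mtens m n · mtens m' n' = mtens (m · m') (n · n').
Proof.
apply: multiplier_eq; apply: linear_tensor_eq => a b /=.
  by rewrite -[LHS]/(lmul (mtens m n) (lmul (mtens m' n') (a ⊗ b))) !lmul_mtens.
by rewrite -[LHS]/(rmul (mtens m' n') (rmul (mtens m n) (a ⊗ b))) !rmul_mtens.
Qed.

Lemma massocM (C : nuAlgType K) (m n : multiplier (tensor A (tensor B C))) :
  massoc (m · n) = massoc m · massoc n.
Proof.
apply: multiplier_eq => x.
  rewrite -[LHS]/(assoc_inv (lmul m (lmul n (assoc x)))).
  by rewrite -[RHS]/(assoc_inv (lmul m (assoc (assoc_inv (lmul n (assoc x))))))
    assoc_invK.
rewrite -[LHS]/(assoc_inv (rmul n (rmul m (assoc x)))).
by rewrite -[RHS]/(assoc_inv (rmul n (assoc (assoc_inv (rmul m (assoc x))))))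
  assoc_invK.
Qed.

Lemma massoc_emb (C : nuAlgType K) (t : tensor A (tensor B C)) :
  massoc (emb t) = emb (assoc_inv t).
Proof.
apply: multiplier_eq => x; last first.
  by rewrite -[LHS]/(assoc_inv (assoc x · t)) assoc_invM assocK.
by rewrite -[LHS]/(assoc_inv (t · assoc x)) assoc_invM assocK.
Qed.

End Multipliers.

Section Opposite.
Context {K : fieldType}.

(** Only the product changes: the vector space structure is copied, so tensors over [opposite A] are
    convertible to tensors over A. *)
Definition opposite (A : nuAlgType K) : Type := A.
HB.instance Definition _ (A : nuAlgType K) := GRing.Lmodule.copy (opposite A) A.

Context {A : nuAlgType K}.
Definition op_mul (a b : opposite A) : opposite A := (b : A) · (a : A).
Fact op_mulA : associative op_mul.
Proof. by move=> a b c; rewrite /op_mul mulgA. Qed.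
HB.instance Definition _ := isSemigroup.Build (opposite A) op_mulA.
Fact op_mulDl (a b c : opposite A) : (a + b : opposite A) · c = a · c + b · c.
Proof. exact (@nu_mulDr K A c a b). Qed.
Fact op_mulDr (a b c : opposite A) : a · (b + c : opposite A) = a · b + a · c.
Proof. exact (@nu_mulDl K A b c a). Qed.
Fact op_mulZl (k : K) (a b : opposite A) : (k *: a : opposite A) · b = k *: (a · b).
Proof. exact (@nu_mulZr K A k b a). Qed.
Fact op_mulZr (k : K) (a b : opposite A) : a · (k *: b : opposite A) = k *: (a · b).
Proof. exact (@nu_mulZl K A k b a). Qed.
HB.instance Definition _ := Lmodule_Semigroup_isNuAlgebra.Build K (opposite A)
  op_mulDl op_mulDr op_mulZl op_mulZr.

Lemma op_tensorM (s t : tensor (opposite A) (opposite A)) :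
  s · t = ((t : tensor A A) · (s : tensor A A)).
Proof.
elim/(@tensor_ind K (opposite A) (opposite A)): t => [|t t' h h'|u v].
- by rewrite nu_mul0r; apply/esym; exact: (nu_mul0l (s : tensor A A)).
- rewrite nu_mulDr h h'; apply/esym; exact: (nu_mulDl (t : tensor A A)).
rewrite tensor_mul_tens_r; apply/esym.
exact: (tensor_mul_tens_l (s : tensor A A)).
Qed.

Lemma op_nondegenerate :
  nondegenerate_algebra A -> nondegenerate_algebra (opposite A).
Proof. by case=> nl nr; split. Qed.

Lemma op_faithful (phi : {scalar A}) :
  faithful_functional phi -> @faithful_functional K (opposite A) phi.
Proof. by case=> fl fr; split. Qed.

End Opposite.

(** * The canonical maps of a coproduct *)

Section CanonicalMaps.
Context {K : fieldType} {A : nuAlgType K}.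
Variable Delta : {linear A -> multiplier (tensor A A)}.
Implicit Types t : {linear tensor A A -> tensor A A}.

HB.instance Definition _ :=
  GRing.isLinear.Build K (tensor A A) (multiplier (tensor (tensor A A) A)) *:%R
    (Delta_id Delta) (tensor_lift_is_linear (Delta_id_bilin Delta)).
HB.instance Definition _ :=
  GRing.isLinear.Build K (tensor A A) (multiplier (tensor (tensor A A) A)) *:%R
    (id_Delta Delta) (tensor_lift_is_linear (id_Delta_bilin Delta)).

Definition lifts_T1 t := forall a b, emb (t (a ⊗ b)) = Delta a · one_tens b.
Definition lifts_T2 t := forall c a, emb (t (c ⊗ a)) = tens_one c · Delta a.
Definition lifts_T3 t := forall a b, emb (t (a ⊗ b)) = one_tens b · Delta a.
Definition lifts_T4 t := forall c a, emb (t (c ⊗ a)) = Delta a · tens_one c.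

(** Preimages under [emb] are unique, so choosing them yields a linear map. *)
Lemma regular_map_lift (T : tensor A A -> multiplier (tensor A A)) :
  injective (@emb K (tensor A A)) -> linear T -> regular_map T ->
  exists t, forall x, emb (t x) = T x.
Proof.
move=> inj lT reg; pose t x := projT1 (cid (reg x)).
have tE x : emb (t x) = T x by rewrite /t; case: cid.
have t_linear : linear t by move=> k x y; apply: inj; rewrite emb_linear !tE lT.
pose t' : {linear tensor A A -> tensor A A} :=
  HB.pack t (GRing.isLinear.Build K (tensor A A) (tensor A A) *:%R t t_linear).
by exists t'.
Qed.

Lemma bijective_onto_tensor_lift (T : tensor A A -> multiplier (tensor A A)) t :
  injective (@emb K (tensor A A)) -> (forall x, emb (t x) = T x) -> bijective t ->
  bijective_onto_tensor T.
Proof.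
move=> inj tE [t' tK t'K]; split=> [x _|x y _ _|_ [y _ <-]].
- by exists (t x).
- by rewrite -!tE => /inj /(can_inj tK).
- by exists (t' y); rewrite // -tE t'K.
Qed.

Lemma emb_lmul1 c (x : tensor A A) :
  emb (tmap (nu_lmul c) idfun x) = tens_one c · emb x.
Proof.
elim/(@tensor_ind K A A): x => [|x y h h'|u v].
- by rewrite !linear0 nu_mul0r.
- by rewrite !linearD /= h h' nu_mulDr.
- by rewrite tmapE !emb_tens mtensM -embM mul1g.
Qed.

Lemma emb_rmul1 c (x : tensor A A) :
  emb (tmap (nu_rmul c) idfun x) = emb x · tens_one c.
Proof.
elim/(@tensor_ind K A A): x => [|x y h h'|u v].
- by rewrite !linear0 nu_mul0l.
- by rewrite !linearD /= h h' nu_mulDl.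
- by rewrite tmapE !emb_tens mtensM -embM mulg1.
Qed.

Lemma emb_lmul2 b (x : tensor A A) :
  emb (tmap idfun (nu_lmul b) x) = one_tens b · emb x.
Proof.
elim/(@tensor_ind K A A): x => [|x y h h'|u v].
- by rewrite !linear0 nu_mul0r.
- by rewrite !linearD /= h h' nu_mulDr.
- by rewrite tmapE !emb_tens mtensM -embM mul1g.
Qed.

Lemma emb_rmul2 b (x : tensor A A) :
  emb (tmap idfun (nu_rmul b) x) = emb x · one_tens b.
Proof.
elim/(@tensor_ind K A A): x => [|x y h h'|u v].
- by rewrite !linear0 nu_mul0l.
- by rewrite !linearD /= h h' nu_mulDl.
- by rewrite tmapE !emb_tens mtensM -embM mulg1.
Qed.

Lemma Delta_id_tens a b : Delta_id Delta (a ⊗ b) = mtens (Delta a) (emb b).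
Proof. exact: (tensor_lift_tens (Delta_id_bilin Delta)). Qed.
Lemma id_Delta_tens a b :
  id_Delta Delta (a ⊗ b) = massoc (mtens (emb a) (Delta b)).
Proof. exact: (tensor_lift_tens (id_Delta_bilin Delta)). Qed.

(** This and the next lemmas place both sides of coassociativity in A ⊗ A ⊗ A, turning it into the
    identity of tensors [coassoc_pair]. *)
Lemma Delta_id_T4 t c : lifts_T4 t -> forall y,
  Delta_id Delta y · mtens (tens_one c) 1%g = emb (tmap (t \o tensl c) idfun y).
Proof.
move=> ht; elim/(@tensor_ind K A A) => [|x y h h'|u v].
- by rewrite !linear0 nu_mul0l.
- by rewrite !linearD /= nu_mulDl h h'.
rewrite Delta_id_tens mtensM -ht mulg1.
by rewrite tmapE emb_tens.
Qed.

Lemma Delta_id_T2 t c : lifts_T2 t -> forall y,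
  mtens (tens_one c) 1%g · Delta_id Delta y = emb (tmap (t \o tensl c) idfun y).
Proof.
move=> ht; elim/(@tensor_ind K A A) => [|x y h h'|u v].
- by rewrite !linear0 nu_mul0r.
- by rewrite !linearD /= nu_mulDr h h'.
rewrite Delta_id_tens mtensM -ht mul1g.
by rewrite tmapE emb_tens.
Qed.

Lemma mtens1_emb (b : A) :
  mtens (1%g : multiplier (tensor A A)) (emb b) = massoc (mtens 1%g (one_tens b)).
Proof. by rewrite massoc_mtens mtens1. Qed.

Lemma id_Delta_T1 t b : lifts_T1 t -> forall z,
  id_Delta Delta z · mtens 1%g (emb b) =
  emb (assoc_inv (tmap idfun (t \o tensr b) z)).
Proof.
move=> ht; elim/(@tensor_ind K A A) => [|x y h h'|u v].
- by rewrite !linear0 nu_mul0l.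
- by rewrite !linearD /= nu_mulDl h h'.
rewrite id_Delta_tens mtens1_emb -massocM mtensM.
by rewrite -ht mulg1 tmapE -emb_tens massoc_emb.
Qed.

Lemma id_Delta_T3 t b : lifts_T3 t -> forall z,
  mtens 1%g (emb b) · id_Delta Delta z =
  emb (assoc_inv (tmap idfun (t \o tensr b) z)).
Proof.
move=> ht; elim/(@tensor_ind K A A) => [|x y h h'|u v].
- by rewrite !linear0 nu_mul0r.
- by rewrite !linearD /= nu_mulDr h h'.
rewrite id_Delta_tens mtens1_emb -massocM mtensM.
by rewrite -ht mul1g tmapE -emb_tens massoc_emb.
Qed.

(** * Coassociativity for a prescribed pair of canonical maps *)

Hypothesis nd : nondegenerate_algebra A.
Context {phi : {scalar A}}.
Hypothesis fphi : faithful_functional phi.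

Let nd2 := nondegenerate_tensor nd fphi.
Let inj2 := emb_inj nd2.
Let inj3 := emb_inj (nondegenerate_tensor nd2 fphi).

Lemma T1_T3 t1 t3 : lifts_T1 t1 -> lifts_T3 t3 -> forall a b b',
  tmap idfun (nu_lmul b') (t1 (a ⊗ b)) = tmap idfun (nu_rmul b) (t3 (a ⊗ b')).
Proof.
by move=> h1 h3 a b b'; apply: inj2; rewrite emb_lmul2 emb_rmul2 h1 h3 mulgA.
Qed.

Lemma T4_T2 t4 t2 : lifts_T4 t4 -> lifts_T2 t2 -> forall a c c',
  tmap (nu_lmul c') idfun (t4 (c ⊗ a)) = tmap (nu_rmul c) idfun (t2 (c' ⊗ a)).
Proof.
by move=> h4 h2 a c c'; apply: inj2; rewrite emb_lmul1 emb_rmul1 h4 h2 mulgA.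
Qed.

Let sepl := left_faithful_separates fphi.1.
Let sepr := right_faithful_separates fphi.2.

Let lift1 : regular_map (T1 Delta) -> exists t, lifts_T1 t.
Proof.
have lT := tensor_lift_is_linear (T1_bilin Delta).
move=> /(@regular_map_lift (T1 Delta) inj2 lT)[t ht].
by exists t => a b; rewrite ht T1_tens.
Qed.
Let lift2 : regular_map (T2 Delta) -> exists t, lifts_T2 t.
Proof.
have lT := tensor_lift_is_linear (T2_bilin Delta).
move=> /(@regular_map_lift (T2 Delta) inj2 lT)[t ht].
by exists t => a b; rewrite ht T2_tens.
Qed.
Let lift3 : regular_map (T3 Delta) -> exists t, lifts_T3 t.
Proof.
have lT := tensor_lift_is_linear (T3_bilin Delta).
move=> /(@regular_map_lift (T3 Delta) inj2 lT)[t ht].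
by exists t => a b; rewrite ht T3_tens.
Qed.
Let lift4 : regular_map (T4 Delta) -> exists t, lifts_T4 t.
Proof.
have lT := tensor_lift_is_linear (T4_bilin Delta).
move=> /(@regular_map_lift (T4 Delta) inj2 lT)[t ht].
by exists t => a b; rewrite ht T4_tens.
Qed.

Lemma coproduct_coassoc_pair : is_coproduct Delta -> exists X Y,
  [/\ lifts_T2 X \/ lifts_T4 X, lifts_T1 Y \/ lifts_T3 Y & coassoc_pair X Y].
Proof.
case=> _; case=> -[].
- move=> /lift1[t1 h1] /lift2[t2 h2] co; exists t2, t1; split; auto=> a b c.
  by apply: inj3; rewrite -(Delta_id_T2 _ h2) -(id_Delta_T1 _ h1); exact: (co a).
- move=> /lift3[t3 h3] /lift4[t4 h4] co; exists t4, t3; split; auto=> a b c.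
  by apply: inj3; rewrite -(Delta_id_T4 _ h4) -(id_Delta_T3 _ h3); exact: (co a).
- move=> /lift1[t1 h1] /lift4[t4 h4] co; exists t4, t1; split; auto=> a b c.
  by apply: inj3; rewrite -(Delta_id_T4 _ h4) -(id_Delta_T1 _ h1); exact: (co a).
- move=> /lift2[t2 h2] /lift3[t3 h3] co; exists t2, t3; split; auto=> a b c.
  by apply: inj3; rewrite -(Delta_id_T2 _ h2) -(id_Delta_T3 _ h3); exact: (co a).
Qed.

(** Whichever form of coassociativity is given, its last-leg map is first replaced by T1, then its
    first-leg map by T4. *)
Lemma coproduct_coassoc14 t1 t4 : is_coproduct Delta ->
  lifts_T1 t1 -> lifts_T4 t4 -> coassoc_pair t4 t1.
Proof.
move=> /coproduct_coassoc_pair[X [Y [hX hY co]]] h1 h4.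
have {hY co}co : coassoc_pair X t1.
  case: hY => hY; last first.
    by apply: (coassoc_pair_right sepr _ co) => a b b'; apply/esym/T1_T3.
  apply: coassoc_pair_ext co => //; apply: linear_tensor_eq => a b.
  by apply: inj2; rewrite hY h1.
case: hX => hX.
  by apply: (coassoc_pair_left sepr _ co) => a b b'; apply/esym/T4_T2.
apply: coassoc_pair_ext co => //; apply: linear_tensor_eq => a b.
by apply: inj2; rewrite hX h4.
Qed.

Lemma coproduct_coassoc23 t2 t3 : is_coproduct Delta ->
  lifts_T2 t2 -> lifts_T3 t3 -> coassoc_pair t2 t3.
Proof.
move=> /coproduct_coassoc_pair[X [Y [hX hY co]]] h2 h3.
have {hY co}co : coassoc_pair X t3.
  case: hY => hY.
    by apply: (coassoc_pair_right sepl _ co) => a b b'; apply: T1_T3.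
  apply: coassoc_pair_ext co => //; apply: linear_tensor_eq => a b.
  by apply: inj2; rewrite hY h3.
case: hX => hX; last first.
  by apply: (coassoc_pair_left sepl _ co) => a b b'; apply: T4_T2.
apply: coassoc_pair_ext co => //; apply: linear_tensor_eq => a b.
by apply: inj2; rewrite hX h2.
Qed.

Lemma regular_multiplier_Hopf_intro t1 t2 t3 t4 : is_coproduct Delta ->
  lifts_T1 t1 -> lifts_T2 t2 -> lifts_T3 t3 -> lifts_T4 t4 ->
  bijective t1 -> bijective t2 -> bijective t3 -> bijective t4 ->
  regular_multiplier_Hopf_algebra Delta.
Proof.
move=> co h1 h2 h3 h4 b1 b2 b3 b4.
have embE t (f : A -> A -> multiplier (tensor A A)) : bilin f ->
    (forall a b, emb (t (a ⊗ b)) = f a b) -> forall x, emb (t x) = tensor_lift f x.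
  move=> bf tf; apply: tensor_eq => [k x y|k x y|u v].
  - by rewrite !linearP.
  - exact: tensor_lift_is_linear.
  - by rewrite tf tensor_lift_tens.
have E1 := embE _ _ (T1_bilin Delta) h1; have E2 := embE _ _ (T2_bilin Delta) h2.
have E3 := embE _ _ (T3_bilin Delta) h3; have E4 := embE _ _ (T4_bilin Delta) h4.
split; [split=> // | split | |].
- by split=> x; [exists (t1 x)|exists (t2 x)]; rewrite ?E1 ?E2.
- exact: bijective_onto_tensor_lift E1 b1.
- exact: bijective_onto_tensor_lift E2 b2.
- by move=> x; exists (t3 x); rewrite E3.
- by move=> x; exists (t4 x); rewrite E4.
- exact: bijective_onto_tensor_lift E3 b3.
- exact: bijective_onto_tensor_lift E4 b4.
Qed.

Lemma lifts_T1_mul t : lifts_T1 t -> forall a b x y,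
  t (a ⊗ b) · (x ⊗ y) = lmul (Delta a) (x ⊗ (b · y)).
Proof.
move=> ht a b x y; rewrite -[LHS]/(lmul (emb (t (a ⊗ b))) (x ⊗ y)) ht.
by rewrite -[LHS]/(lmul (Delta a) (lmul (one_tens b) (x ⊗ y))) lmul_mtens.
Qed.

Lemma lifts_T2_mul t : lifts_T2 t -> forall c a x y,
  (x ⊗ y) · t (c ⊗ a) = rmul (Delta a) ((x · c) ⊗ y).
Proof.
move=> ht c a x y; rewrite -[LHS]/(rmul (emb (t (c ⊗ a))) (x ⊗ y)) ht.
by rewrite -[LHS]/(rmul (Delta a) (rmul (tens_one c) (x ⊗ y))) rmul_mtens.
Qed.

Lemma lifts_T3_mul t : lifts_T3 t -> forall a b x y,
  (x ⊗ y) · t (a ⊗ b) = rmul (Delta a) (x ⊗ (y · b)).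
Proof.
move=> ht a b x y; rewrite -[LHS]/(rmul (emb (t (a ⊗ b))) (x ⊗ y)) ht.
by rewrite -[LHS]/(rmul (Delta a) (rmul (one_tens b) (x ⊗ y))) rmul_mtens.
Qed.

Lemma lifts_T4_mul t : lifts_T4 t -> forall c a x y,
  t (c ⊗ a) · (x ⊗ y) = lmul (Delta a) ((c · x) ⊗ y).
Proof.
move=> ht c a x y; rewrite -[LHS]/(lmul (emb (t (c ⊗ a))) (x ⊗ y)) ht.
by rewrite -[LHS]/(lmul (Delta a) (lmul (tens_one c) (x ⊗ y))) lmul_mtens.
Qed.

(** * From faithful integrals to regular multiplier Hopf algebras *)

Context {psi : {scalar A}}.
Hypotheses (lphi : left_integral Delta phi) (rpsi : right_integral Delta psi).
Hypotheses (fpsi : faithful_functional psi) (co : is_coproduct Delta).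

(** The definition of the integral has a factor on each side of Delta(a); T4 supplies one, and
    non-degeneracy cancels the other. *)
Lemma left_integral_T4 t : lifts_T4 t -> forall c a,
  rslice phi (t (c ⊗ a)) = phi a *: c.
Proof.
move=> ht c a; apply: nondegenerate_injr nd _ => c'; have [_ _ hphi] := lphi.
rewrite nu_mulZr -(hphi a c' c (tmap (nu_lmul c') idfun (t (c ⊗ a)))).
  by rewrite -[RHS]/(rslice phi _) rslice_tmap.
by rewrite emb_lmul1 ht mulgA.
Qed.

Lemma left_integral_T2 t : lifts_T2 t -> forall c a,
  rslice phi (t (c ⊗ a)) = phi a *: c.
Proof.
move=> ht c a; apply: nondegenerate_injl nd _ => c'; have [_ _ hphi] := lphi.
rewrite nu_mulZl -(hphi a c c' (tmap (nu_rmul c') idfun (t (c ⊗ a)))).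
  by rewrite -[RHS]/(rslice phi _) rslice_tmap.
by rewrite emb_rmul1 ht.
Qed.

Lemma right_integral_T1 t : lifts_T1 t -> forall a b,
  lslice psi (t (a ⊗ b)) = psi a *: b.
Proof.
move=> ht a b; apply: nondegenerate_injr nd _ => b'; have [_ _ hpsi] := rpsi.
rewrite nu_mulZr -(hpsi a b b' (tmap idfun (nu_lmul b') (t (a ⊗ b)))).
  by rewrite -[RHS]/(lslice psi _) lslice_tmap.
by rewrite emb_lmul2 ht mulgA.
Qed.

Lemma right_integral_T3 t : lifts_T3 t -> forall a b,
  lslice psi (t (a ⊗ b)) = psi a *: b.
Proof.
move=> ht a b; apply: nondegenerate_injl nd _ => b'; have [_ _ hpsi] := rpsi.
rewrite nu_mulZl -(hpsi a b' b (tmap idfun (nu_rmul b') (t (a ⊗ b)))).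
  by rewrite -[RHS]/(lslice psi _) lslice_tmap.
by rewrite emb_rmul2 ht.
Qed.

Lemma regular_multiplier_Hopf14 : regular_map (T1 Delta) -> regular_map (T4 Delta) ->
  regular_multiplier_Hopf_algebra Delta.
Proof.
move=> /lift1[t1 h1] /lift4[t4 h4].
have H : integral_pair (fun a => lmul (Delta a)) t1 t4 phi psi.
  apply: integral_pair_intro => //.
  - by case: lphi.
  - by case: rpsi.
  - by move=> a t u; rewrite /= lmulM.
  - by move=> a b t; rewrite /= co.1.
  - exact: lifts_T1_mul.
  - exact: lifts_T4_mul.
  - exact: left_integral_T4.
  - exact: right_integral_T1.
  - exact: coproduct_coassoc14.
have [b1 b4 [t2 b2 h2] [t3 b3 h3]] := integral_pair_bij H.
apply: (@regular_multiplier_Hopf_intro t1 t2 t3 t4) => //.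
- move=> c a; apply: lmul_inj nd2 _; apply: linear_tensor_eq => x y /=.
  exact: h2.
- move=> a b; apply: lmul_inj nd2 _; apply: linear_tensor_eq => x y /=.
  exact: h3.
Qed.

Lemma regular_multiplier_Hopf23 : regular_map (T2 Delta) -> regular_map (T3 Delta) ->
  regular_multiplier_Hopf_algebra Delta.
Proof.
move=> /lift2[t2 h2] /lift3[t3 h3].
(* Over the opposite algebra, right multiplication by Delta(a) becomes left multiplication, and T3,
   T2 take the roles of T1, T4. *)
pose D (a : A) : {linear tensor A A -> tensor A A} := rmul (Delta a).
have H : @integral_pair K (opposite A) D t3 t2 phi psi.
  apply: integral_pair_intro.
  - exact: op_nondegenerate.
  - by case: lphi.
  - by case: rpsi.
  - exact: op_faithful.
  - exact: op_faithful.
  - move=> a t u; rewrite !op_tensorM.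
    exact (@rmulM K (tensor A A) (Delta a) u t).
  - move=> a b t; rewrite /D /= -[(a · b)%g]/((b : A) · (a : A)) co.1.
    by [].
  - move=> a b x y; rewrite op_tensorM; exact (lifts_T3_mul h3 a b x y).
  - move=> c a x y; rewrite op_tensorM; exact (lifts_T2_mul h2 c a x y).
  - exact (left_integral_T2 h2).
  - exact (right_integral_T3 h3).
  - exact (coproduct_coassoc23 co h2 h3).
(* The maps T2 and T3 of the opposite pair are T4 and T1 of A. *)
have [b3 b2 [t4 b4 h4] [t1 b1 h1]] := integral_pair_bij H.
apply: (@regular_multiplier_Hopf_intro t1 t2 t3 t4) => //.
- move=> a b; apply: rmul_inj nd2 _; apply: linear_tensor_eq => x y /=.
  have := h1 a b x y; rewrite op_tensorM; exact.
- move=> c a; apply: rmul_inj nd2 _; apply: linear_tensor_eq => x y /=.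
  have := h4 c a x y; rewrite op_tensorM; exact.
Qed.

End CanonicalMaps.

Theorem theorem2p11 (R : realType) (A : nuAlgType R[i])
    (Delta : {linear A -> multiplier (tensor A A)}) :
  nondegenerate_algebra A -> is_coproduct Delta ->
  (regular_map (T1 Delta) -> regular_map (T4 Delta) ->
   (exists phi : {scalar A}, left_integral Delta phi /\ faithful_functional phi) ->
   (exists psi : {scalar A}, right_integral Delta psi /\ faithful_functional psi) ->
   regular_multiplier_Hopf_algebra Delta) /\
  (regular_map (T2 Delta) -> regular_map (T3 Delta) ->
   (exists phi : {scalar A}, left_integral Delta phi /\ faithful_functional phi) ->
   (exists psi : {scalar A}, right_integral Delta psi /\ faithful_functional psi) ->
   regular_multiplier_Hopf_algebra Delta).
Proof.
move=> nd co; split=> h h' [phi [lphi fphi]] [psi [rpsi fpsi]].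
  exact: (regular_multiplier_Hopf14 nd fphi lphi rpsi).
exact: (regular_multiplier_Hopf23 nd fphi lphi rpsi).
Qed.
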